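(* Every homogeneous distance on a homogeneous group $G$ is continuous on $G\times G$ with respect to the manifold topology.
   Context: All Lie algebras are real and finite-dimensional. A positive grading of a Lie algebra $\mathfrak g$ is a family $(V_t)_{t\in(0,+\infty)}$ of vector subspaces, all but finitely many equal to $\{0\}$, with $\mathfrak g=\bigoplus_{t>0}V_t$ and $[V_s,V_t]\subset V_{s+t}$ for all $s,t>0$. A graded group is a connected and simply connected Lie group $G$ whose Lie algebra $\mathfrak g$ is endowed with a given positive grading. A homogeneous group is a graded group whose grading satisfies $V_t=\{0\}$ for all $t\in(0,1)$. Dilations: for $\lambda>0$, $\delta_\lambda:\mathfrak g\to\mathfrak g$ is the linear map with $\delta_\lambda(X)=\lambda^tX$ for $X\in V_t$; it is a Lie algebra automorphism, and $\delta_\lambda:G\to G$ also denotes the unique Lie group automorphism whose induced Lie algebra map is $\delta_\lambda$. A distance $d$ on $G$ (satisfying the usual metric axioms; no topological compatibility is assumed) is homogeneous if it is left-invariant and $d(\delta_\lambda(p),\delta_\lambda(q))=\lambda d(p,q)$ for all $p,q\in G$ and $\lambda>0$. *)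

(* Defs.v *)
From HB Require Import structures.
From mathcomp Require Import all_boot all_order all_algebra.
From mathcomp Require Import all_classical all_reals all_analysis.

Set Implicit Arguments.
Unset Strict Implicit.
Unset Printing Implicit Defensive.

Import Order.TTheory GRing.Theory Num.Theory.
Import numFieldNormedType.Exports.

Local Open Scope classical_set_scope.
Local Open Scope ring_scope.

(* [Ck_on k U f]: f is of class C^k on the open set U.  This is the usual notion
   for finite-dimensional V; it is used below with V = R^n and V = R^n x R^n. *)
Fixpoint Ck_on (R : realType) (V W : normedModType R) (k : nat) (U : set V)
    (f : V -> W) : Prop :=
  if k is k'.+1 then
    (forall x, U x -> differentiable f x) /\
    (forall v, Ck_on k' U (fun x => 'd f x v))
  else {within U, continuous f}.

Definition smooth_on (R : realType) (V W : normedModType R) (U : set V)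
    (f : V -> W) : Prop :=
  forall k, Ck_on k U f.

(* [chart_map] and [chart_inv] are total functions, of which only the values on
   [chart_dom] and on [chart_map @` chart_dom] are meaningful. *)
Record chart (R : realType) (n : nat) (M : topologicalType) := Chart {
  chart_dom : set M;
  chart_map : M -> 'rV[R]_n;
  chart_inv : 'rV[R]_n -> M;
  chart_dom_open : open chart_dom;
  chart_cod_open : open (chart_map @` chart_dom);
  chart_mapK : {in chart_dom, cancel chart_map chart_inv};
  chart_map_cont : {within chart_dom, continuous chart_map};
  chart_inv_cont : {within chart_map @` chart_dom, continuous chart_inv}
}.

Definition chart_cod (R : realType) (n : nat) (M : topologicalType)
    (c : chart R n M) : set 'rV[R]_n :=
  chart_map c @` chart_dom c.

Definition smooth_atlas (R : realType) (n : nat) (M : topologicalType)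
    (A : set (chart R n M)) : Prop :=
  (forall p, exists2 c, A c & chart_dom c p) /\
  (forall a b, A a -> A b ->
     smooth_on (chart_cod a `&` chart_inv a @^-1` chart_dom b)
       (chart_map b \o chart_inv a)).

Definition smooth_map (R : realType) (n : nat) (M : topologicalType)
    (A : set (chart R n M)) (f : M -> M) : Prop :=
  continuous f /\
  (forall a b, A a -> A b ->
     smooth_on (chart_cod a `&` (f \o chart_inv a) @^-1` chart_dom b)
       (chart_map b \o f \o chart_inv a)).

(* Smoothness of a map M x M -> M, in the product charts of M x M. *)
Definition smooth_map2 (R : realType) (n : nat) (M : topologicalType)
    (A : set (chart R n M)) (f : M * M -> M) : Prop :=
  continuous f /\
  (forall a b c, A a -> A b -> A c ->
     let ab := fun z : 'rV[R]_n * 'rV[R]_n =>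
       (chart_inv a z.1, chart_inv b z.2) in
     smooth_on ((chart_cod a `*` chart_cod b) `&` (f \o ab) @^-1` chart_dom c)
       (chart_map c \o f \o ab)).

HB.mixin Record isLieGroup (R : realType) (n : nat) G
    of Topological G & Group G := {
  lie_hausdorff : hausdorff_space G;
  lie_second_countable : @second_countable G;
  lie_atlas : set (chart R n G);
  lie_atlasP : smooth_atlas lie_atlas;
  lie_mul_smooth : smooth_map2 lie_atlas (fun p : G * G => (p.1 * p.2)%g);
  lie_inv_smooth : smooth_map lie_atlas (fun p : G => p^-1%g)
}.

(* Real Lie groups of dimension n. *)
#[short(type="lieGroupType")]
HB.structure Definition LieGroup (R : realType) (n : nat) :=
  {G of isLieGroup R n G & Topological G & Group G}.

Definition simply_connected (R : realType) (T : topologicalType) : Prop :=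
  forall gamma : R -> T,
    {within `[0, 1], continuous gamma} -> gamma 0 = gamma 1 ->
    exists H : R * R -> T,
      [/\ {within `[0, 1] `*` `[0, 1], continuous H},
          (forall s, 0 <= s <= 1 -> H (s, 0) = gamma s),
          (forall s, 0 <= s <= 1 -> H (s, 1) = gamma 0) &
          (forall t, 0 <= t <= 1 -> H (0, t) = gamma 0 /\ H (1, t) = gamma 0)].

(* In what follows c is a chart at the identity.  Through c the tangent space
   of G at the identity is R^n: the row vector v stands for the tangent vector
   sum_i v_i d/dx_i in the coordinates x given by c. *)

(* The left-invariant vector field with value v at the identity, read in the
   chart c: its value at p is the image of v by the differential at the identity
   of the left translation by p. *)
Definition left_invariant_field (R : realType) (n : nat) (G : lieGroupType R n)
    (c : chart R n G) (v x : 'rV[R]_n) : 'rV[R]_n :=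
  'd (fun y => chart_map c (chart_inv c x * chart_inv c y)%g)
     (chart_map c 1%g) v.

(* [X, Y] = DY.X - DX.Y, the coordinate expression of the bracket of vector
   fields (as derivations, [X, Y] = X Y - Y X). *)
Definition field_bracket (R : realType) (n : nat)
    (X Y : 'rV[R]_n -> 'rV[R]_n) (x : 'rV[R]_n) : 'rV[R]_n :=
  'd Y x (X x) - 'd X x (Y x).

Definition lie_bracket (R : realType) (n : nat) (G : lieGroupType R n)
    (c : chart R n G) (v w : 'rV[R]_n) : 'rV[R]_n :=
  field_bracket (left_invariant_field c v) (left_invariant_field c w)
    (chart_map c 1%g).

(* The Lie algebra map induced by a smooth endomorphism of G. *)
Definition lie_differential (R : realType) (n : nat) (G : lieGroupType R n)
    (c : chart R n G) (phi : G -> G) (v : 'rV[R]_n) : 'rV[R]_n :=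
  'd (chart_map c \o phi \o chart_inv c) (chart_map c 1%g) v.

(* Only the values V t with t > 0 are relevant. *)
Definition positive_grading (R : realType) (n : nat) (G : lieGroupType R n)
    (c : chart R n G) (V : R -> {vspace 'rV[R]_n}) : Prop :=
  (exists s : seq R,
     [/\ uniq s,
         (forall t, t \in s -> 0 < t),
         (forall t, 0 < t -> t \notin s -> V t = 0%VS),
         directv (\sum_(t <- s) V t)%VS &
         (\sum_(t <- s) V t)%VS = fullv]) /\
  (forall s t, 0 < s -> 0 < t -> forall v w, v \in V s -> w \in V t ->
     lie_bracket c v w \in V (s + t)).

Definition graded_group (R : realType) (n : nat) (G : lieGroupType R n)
    (c : chart R n G) (V : R -> {vspace 'rV[R]_n}) : Prop :=
  [/\ connected [set: G], simply_connected R G & positive_grading c V].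

Definition homogeneous_group (R : realType) (n : nat) (G : lieGroupType R n)
    (c : chart R n G) (V : R -> {vspace 'rV[R]_n}) : Prop :=
  graded_group c V /\ (forall t, 0 < t < 1 -> V t = 0%VS).

Definition lie_automorphism (R : realType) (n : nat) (G : lieGroupType R n)
    (phi : G -> G) : Prop :=
  {morph phi : p q / (p * q)%g} /\
  exists psi : G -> G,
    [/\ cancel phi psi, cancel psi phi,
        smooth_map (lie_atlas (s := G)) phi &
        smooth_map (lie_atlas (s := G)) psi].

Definition algebra_dilation (R : realType) (n : nat)
    (V : R -> {vspace 'rV[R]_n}) (lam : R) (f : 'rV[R]_n -> 'rV[R]_n) : Prop :=
  linear f /\ (forall t, 0 < t -> forall v, v \in V t -> f v = lam `^ t *: v).

Definition group_dilation (R : realType) (n : nat) (G : lieGroupType R n)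
    (c : chart R n G) (V : R -> {vspace 'rV[R]_n}) (lam : R)
    (phi : G -> G) : Prop :=
  lie_automorphism phi /\ algebra_dilation V lam (lie_differential c phi).

Definition is_distance (R : realType) (T : Type) (d : T -> T -> R) : Prop :=
  [/\ (forall p q, 0 <= d p q),
      (forall p q, d p q = 0 <-> p = q),
      (forall p q, d p q = d q p) &
      (forall p q r, d p r <= d p q + d q r)].

Definition homogeneous_distance (R : realType) (n : nat) (G : lieGroupType R n)
    (dil : R -> G -> G) (d : G -> G -> R) : Prop :=
  [/\ is_distance d,
      (forall g p q, d (g * p)%g (g * q)%g = d p q) &
      (forall lam p q, 0 < lam -> d (dil lam p) (dil lam q) = lam * d p q)].

(* Main.v *)
Require Import Defs.
From HB Require Import structures.
From mathcomp Require Import all_boot all_order all_algebra.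
From mathcomp Require Import all_classical all_reals all_analysis.
From mathcomp Require Import ring lra.

Import Order.TTheory GRing.Theory Num.Theory.
Import numFieldNormedType.Exports.

Local Open Scope classical_set_scope.
Local Open Scope ring_scope.

(** The gauge [f p := d 1 p] determines the distance, [d p q = f (p^-1 q)]; it is
    subadditive and satisfies [f (dil lam p) = lam * f p].  By the triangle
    inequality [d] is continuous as soon as [f] tends to 0 at the identity.  The
    dilation [dil lam] is a homeomorphism that fixes the identity, so a bound [B]
    for [f] on a neighbourhood [U] of 1 gives the bound [lam * B] on the
    neighbourhood [dil lam U].  Everything is thus reduced to [gauge_bounded]: [f]
    is bounded near the identity.

    For this, let [v] be a small vector of [V t].  For [0 < lam <= 1] one has
    [exp (lam^t v) = dil lam (exp v)], hence [f (exp (b v)) <= f (exp v)] for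
    [0 < b <= 1].  Choose finitely many homogeneous vectors [Y i] and linear forms
    [l i] with [v = sum_i l_i(v) Y_i] for all [v].  The map
    [v |-> prod_i exp (l_i(v) Y_i)] has the identity as its strict derivative at
    0, so that its values fill a neighbourhood of 1 ([exp_product_cover]), where
    subadditivity bounds [f] by the sum of the numbers [f (exp (+- a Y_i))].

    The argument needs an exponential that every smooth automorphism intertwines
    with its differential.  It is obtained without differential equations, by
    linearizing the squaring map of the group.  In a chart centred at 1 the product
    is [x + y] up to a term of second order (a mean value estimate for a map of
    class C^2, [second_order_bound]), so squaring has a local inverse [sigma] which
    is [x / 2] up to second order ([local_group_sqrt]).  The limit
    [L x = lim 2^k sigma^k x] is the logarithm ([local_sqrt_log]), and the local
    inverse of [L] is the exponential.  A morphism commutes with square roots near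
    1, so [L] conjugates it to its derivative there; repeated squaring carries the
    conjugacy to a ball that does not depend on the morphism ([local_group_exp]).
    This uniformity matters, since the family of dilations is not assumed to be
    continuous in its parameter. *)

Set Implicit Arguments.
Unset Strict Implicit.
Unset Printing Implicit Defensive.

(** * Linear identities *)

(** Equalities between vectors are proved by reflection: two formal linear
    combinations with the same coefficients take the same value, and the equality
    of coefficients is left to [ring]. *)
Inductive lincomb (R : comNzRingType) :=
  | LVar of nat
  | LZero
  | LAdd of lincomb R & lincomb R
  | LOpp of lincomb R
  | LScale of R & lincomb R.
Arguments LVar {R}.
Arguments LZero {R}.

Fixpoint lin_eval (R : comNzRingType) (E : lmodType R) (env : seq E)
    (e : lincomb R) : E :=
  match e with
  | LVar i => nth 0 env i
  | LZero => 0
  | LAdd a b => lin_eval env a + lin_eval env b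
  | LOpp a => - lin_eval env a
  | LScale c a => c *: lin_eval env a
  end.

Fixpoint lin_coef (R : comNzRingType) (i : nat) (e : lincomb R) : R :=
  match e with
  | LVar j => if Nat.eqb i j then 1 else 0
  | LZero => 0
  | LAdd a b => lin_coef i a + lin_coef i b
  | LOpp a => - lin_coef i a
  | LScale c a => c * lin_coef i a
  end.

Fixpoint same_coefs (R : comNzRingType) (n : nat) (a b : lincomb R) : Prop :=
  if n is k.+1 then lin_coef k a = lin_coef k b /\ same_coefs k a b else True.

Lemma lin_evalE (R : comNzRingType) (E : lmodType R) (env : seq E)
    (e : lincomb R) :
  lin_eval env e = \sum_(i < size env) lin_coef i e *: nth 0 env i.
Proof.
elim: e => [j||a iha b ihb|a iha|c a iha] /=.
- have eqbE (i : nat) : Nat.eqb i j = (i == j).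
    by apply/idP/eqP => [/PeanoNat.Nat.eqb_eq|->] //; exact: PeanoNat.Nat.eqb_refl.
  have [jlt|jge] := ltnP j (size env); last first.
    rewrite nth_default // big1 // => i _; rewrite eqbE.
    by rewrite ltn_eqF ?scale0r // (leq_trans (ltn_ord i)).
  rewrite (bigD1 (Ordinal jlt)) //= eqbE eqxx scale1r big1 ?addr0 // => i ne.
  by rewrite eqbE -[(i : nat) == j]/(i == Ordinal jlt) (negPf ne) scale0r.
- by rewrite big1 // => i _; rewrite scale0r.
- by rewrite iha ihb -big_split; apply: eq_bigr => i _; rewrite scalerDl.
- by rewrite iha -sumrN; apply: eq_bigr => i _; rewrite scaleNr.
- by rewrite iha scaler_sumr; apply: eq_bigr => i _; rewrite scalerA.
Qed.

Lemma same_coefs_eval (R : comNzRingType) (E : lmodType R) (env : seq E)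
    (a b : lincomb R) :
  same_coefs (size env) a b -> lin_eval env a = lin_eval env b.
Proof.
rewrite !lin_evalE => ab; apply: eq_bigr => i _; congr (_ *: _).
elim: (size env) i ab => [[]//|k ih] i /= [abk abs].
have [ik|ik] := ltnP i k; first exact: (ih (Ordinal ik)).
by have -> : (i : nat) = k; [apply/eqP; rewrite eqn_leq ik -ltnS ltn_ord|].
Qed.

Ltac lin_index x env :=
  lazymatch env with
  | x :: _ => constr:(0%N)
  | _ :: ?env' => let i := lin_index x env' in constr:(S i)
  end.

Ltac lin_atoms env t :=
  lazymatch t with
  | 0%R => env
  | (?a + ?b)%R => let env' := lin_atoms env a in lin_atoms env' b
  | (- ?a)%R => lin_atoms env a
  | (_ *: ?a)%R => lin_atoms env a
  | _ => match goal with
         | _ => let i := lin_index t env in env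
         | _ => constr:(t :: env)
         end
  end.

Ltac lin_reify R env t :=
  lazymatch t with
  | 0%R => constr:(@LZero R)
  | (?a + ?b)%R =>
      let a' := lin_reify R env a in let b' := lin_reify R env b in
      constr:(@LAdd R a' b')
  | (- ?a)%R => let a' := lin_reify R env a in constr:(@LOpp R a')
  | (?c *: ?a)%R => let a' := lin_reify R env a in constr:(@LScale R c a')
  | _ => let i := lin_index t env in constr:(@LVar R i)
  end.

(** The syntactically distinct subterms that are not sums, opposites or multiples
    serve as independent vectors. *)
Ltac linear_identity R :=
  match goal with
  | |- @eq ?E ?a ?b =>
      let env := lin_atoms (@nil E) a in
      let env := lin_atoms env b in
      let a' := lin_reify R env a in
      let b' := lin_reify R env b in
      apply: (@same_coefs_eval R _ env a' b');
      cbv [same_coefs size lin_coef Nat.eqb];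
      repeat split; by [ring | field]
  end.

(** * Perturbations of the identity *)

(** Joins the completeness of matrices to their norm. *)
HB.instance Definition _ (R : realType) m n := Complete.on 'M[R]_(m, n).

(** For a linear [A], this says that [A] is the strict derivative of [h] at 0.
    Unlike differentiability at 0, it allows the inversion of [h] near 0 when [A] is
    invertible; unlike class C^1, it asks for no derivative at other points. *)
Definition strictly_tangent (R : realType) (E F : normedModType R)
    (h A : E -> F) : Prop :=
  forall eps, 0 < eps -> exists2 delta, 0 < delta &
    forall x y, `|x| <= delta -> `|y| <= delta ->
      `|h x - h y - (A x - A y)| <= eps * `|x - y|.

Definition half_tangent_id (R : realType) (E : normedModType R)
    (h : E -> E) (rho : R) : Prop :=
  forall x y, `|x| <= rho -> `|y| <= rho ->
    `|h x - h y - (x - y)| <= 2^-1 * `|x - y|.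

Section perturbation.
Context (R : realType) (E : completeNormedModType R).
Implicit Types (h : E -> E) (x y v : E) (rho : R).

Lemma half_tangent_inj h rho x y :
  half_tangent_id h rho -> `|x| <= rho -> `|y| <= rho -> h x = h y -> x = y.
Proof.
move=> hh hx hy e; apply/eqP; rewrite -subr_eq0 -normr_eq0.
have := hh _ _ hx hy; rewrite e subrr sub0r normrN.
by move=> le; apply/eqP; have := normr_ge0 (x - y); lra.
Qed.

(** A solution of [h x = y] is a fixed point of [x |-> y - (h x - x)], which is a
    contraction with constant 1/2 and sends 0 to [y]; it therefore preserves the
    ball of radius [2 |y|]. *)
Lemma half_tangent_surj h rho y :
  h 0 = 0 -> half_tangent_id h rho -> 2 * `|y| <= rho ->
  exists2 x, `|x| <= 2 * `|y| & h x = y.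
Proof.
move=> h0 hh hy.
pose U : set E := [set x | `|x| <= 2 * `|y|].
pose T x := y - (h x - x).
have Tsub x z : T x - T z = - (h x - h z - (x - z)).
  by rewrite /T; linear_identity R.
have Uy : 0 <= 2 * `|y| by rewrite mulr_ge0.
have U0 : U 0 by rewrite /U /= normr0.
have Ule x : U x -> `|x| <= rho by move=> /le_trans; exact.
have T_lip x z : U x -> U z -> `|T x - T z| <= 2^-1 * `|x - z|.
  by move=> Ux Uz; rewrite Tsub normrN; apply: hh; exact: Ule.
have TU : {homo T : x / U x >-> U x}.
  move=> x Ux; have := T_lip _ _ Ux U0; rewrite subr0 => Tx0.
  have T0 : T 0 = y by rewrite /T h0 subrr subr0.
  have := ler_normD (T x - T 0) (T 0); rewrite subrK T0.
  by move: Ux Tx0; rewrite /U /= T0; lra.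
pose TF := HB.pack_for {fun U >-> U} T (isFun.Build _ _ U U T TU).
have [|||x Ux xT] := @banach_fixed_point R E U TF.
- exists (2^-1)%:nng; split; rewrite /=; first by lra.
  by move=> [x z] [/= Ux Uz]; exact: T_lip.
- rewrite (_ : U = closed_ball_ Num.norm 0 (2 * `|y|)); first exact: closed_closed_ball_.
  by apply/seteqP; split => x; rewrite /U /closed_ball_ /= sub0r normrN.
- by exists 0.
exists x => //; apply/eqP; rewrite -subr_eq0.
have -> : h x - y = x - T x by rewrite /T; linear_identity R.
by move: xT; rewrite /TF /= => <-; rewrite subrr.
Qed.

(** Inverse function theorem for a strict derivative equal to the identity.  The
    inverse is only controlled on the ball of radius [rho], and its values stay in
    the larger ball on which [h] is injective. *)
Lemma strictly_tangent_inverse h :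
  h 0 = 0 -> strictly_tangent h id ->
  exists2 rho, 0 < rho & exists e : E -> E,
    [/\ half_tangent_id h (2 * rho),
        forall v, `|v| <= rho -> `|e v| <= 2 * `|v| /\ h (e v) = v,
        e 0 = 0 & strictly_tangent e id].
Proof.
move=> h0 hT; have [|d d0 hd] := hT (2^-1); first by rewrite invr_gt0.
have hh : half_tangent_id h d by [].
have /choice [e eP] : forall v, exists x, `|v| <= d / 2 ->
    `|x| <= 2 * `|v| /\ h x = v.
  move=> v; have [vd|] := boolP (`|v| <= d / 2); last by exists 0.
  have [|x xv hx] := half_tangent_surj h0 hh (y := v); first by lra.
  by exists x.
have d20 : 0 < d / 2 by lra.
exists (d / 2) => //; exists e; split => //.
- by rewrite (_ : 2 * _ = d) //; lra.
- have [] := eP 0; rewrite normr0; first exact: ltW.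
  by rewrite mulr0 normr_le0 => /eqP.
move=> eps eps0.
have [|d' d'0 hd'] := hT (Num.min (eps / 2) (2^-1)).
  by rewrite lt_min; apply/andP; split; lra.
exists (Num.min (d / 2) (d' / 2)); first by rewrite lt_min; apply/andP; split; lra.
move=> x y; rewrite !le_min => /andP[xd xd'] /andP[yd yd'].
have [ex hx] := eP _ xd; have [ey hy] := eP _ yd.
have ex' : `|e x| <= d' by lra.
have ey' : `|e y| <= d' by lra.
have := hd' _ _ ex' ey'; rewrite hx hy.
have -> : x - y - (e x - e y) = - (e x - e y - (x - y)) by linear_identity R.
rewrite normrN => le.
have := ler_normD (e x - e y - (x - y)) (x - y); rewrite subrK => le'.
(* the bound 1/2 gives |e x - e y| <= 2 |x - y|, and eps / 2 then gives the claim *)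
set c := Num.min _ _ in le; set a := `|e x - e y| in le le'.
have a0 : 0 <= a by exact: normr_ge0.
have : c * a <= 2^-1 * a by rewrite ler_wpM2r // ge_min lexx orbT.
have : c * a <= eps / 2 * a by rewrite ler_wpM2r // ge_min lexx.
move=> c1 c2; have a2 : a <= 2 * `|x - y| by lra.
have := ler_wpM2l (ltW eps0) a2; lra.
Qed.

End perturbation.

(** * Square roots, logarithm and exponential of a local group *)

(** [g] stands for the inverse of a chart centred at the identity and [m] for the
    product of the group read in that chart.  The last field says that [m] is
    tangent to the addition up to second order; a product of class C^2 has this
    property, and it makes [2^k sigma^k] below a Cauchy sequence. *)
Record local_group (R : realType) (E : normedModType R) (G : groupType)
    (g : E -> G) (m : E -> E -> E) (r C : R) : Prop := LocalGroup {
  lg_radius : 0 < r;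
  lg_const : 0 < C;
  lg_one : g 0 = 1%g;
  lg_inj : forall x y, `|x| <= r -> `|y| <= r -> g x = g y -> x = y;
  lg_mul : forall x y, `|x| <= r -> `|y| <= r -> g (m x y) = (g x * g y)%g;
  lg_mul0 : m 0 0 = 0;
  lg_quad : forall x y x' y',
    `|x| <= r -> `|y| <= r -> `|x'| <= r -> `|y'| <= r ->
    `|m x y - m x' y' - (x + y - (x' + y'))|
      <= C * (`|x| + `|y| + `|x'| + `|y'|) * (`|x - x'| + `|y - y'|)
}.

(** [sigma] is the square root near the identity, read in the chart.  The constant
    3/5 may be any number larger than 1/2, the derivative of [sigma] at 0, whose
    square is less than 1/2: this makes [2^k sigma^k] converge. *)
Record local_sqrt (R : realType) (E : normedModType R) (G : groupType)
    (g : E -> G) (sigma : E -> E) (rho C : R) : Prop := LocalSqrt {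
  sqrt_radius : 0 < rho;
  sqrt_const : 0 < C;
  sqrt_norm : forall x, `|x| <= rho -> `|sigma x| <= 3 / 5 * `|x|;
  sqrt_sq : forall x, `|x| <= rho -> (g (sigma x) * g (sigma x) = g x)%g;
  sqrt_uniq : forall x y, `|x| <= rho -> `|y| <= rho ->
    (g y * g y = g x)%g -> y = sigma x;
  sqrt_lip : forall x y, `|x| <= rho -> `|y| <= rho ->
    `|sigma x - sigma y| <= 3 / 5 * `|x - y|;
  sqrt_quad : forall x y, `|x| <= rho -> `|y| <= rho ->
    `|sigma x - sigma y - 2^-1 *: (x - y)| <= C * (`|x| + `|y|) * `|x - y|
}.

Section local_group.
Context (R : realType) (E : completeNormedModType R) (G : groupType).
Implicit Types (g : E -> G) (m : E -> E -> E) (r rho C : R).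

(** Squaring is [x |-> m x x], and half of it is a perturbation [h] of the identity
    by a term of second order: [sigma y] is the solution of [h x = y / 2]. *)
Lemma local_group_sqrt g m r C : local_group g m r C ->
  exists2 rho, rho <= r & exists sigma, local_sqrt g sigma rho C.
Proof.
case=> r0 C0 g0 ginj gm m0 mq.
(* r / 3 keeps the squares of the ball in the domain where g is injective, and
   1 / (80 C) makes h - id Lipschitz with constant 1/20 *)
pose rho := Num.min (r / 3) (80 * C)^-1.
have rho0 : 0 < rho by rewrite lt_min; apply/andP; split; [lra|rewrite invr_gt0; lra].
have rho_r : 3 * rho <= r.
  by have : rho <= r / 3 by [rewrite ge_min lexx]; lra.
have rho_C : C * rho <= 80^-1.
  have : rho <= (80 * C)^-1 by rewrite ge_min lexx orbT.
  move=> /(ler_wpM2l (ltW C0)); rewrite invfM mulrCA divff ?mulr1 //.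
  exact: lt0r_neq0.
pose h x := 2^-1 *: m x x.
have hq x y : `|x| <= r -> `|y| <= r ->
    `|h x - h y - (x - y)| <= 2 * C * (`|x| + `|y|) * `|x - y|.
  move=> xr yr; have le := mq _ _ _ _ xr xr yr yr.
  have -> : h x - h y - (x - y) = 2^-1 *: (m x x - m y y - (x + x - (y + y))).
    by rewrite /h; linear_identity R.
  by rewrite normrZ ger0_norm; [lra|lra].
have h20 x y : `|x| <= rho -> `|y| <= rho ->
    `|h x - h y - (x - y)| <= 20^-1 * `|x - y|.
  move=> xr yr; apply: le_trans (hq x y _ _) _; [by lra|by lra|].
  apply: ler_wpM2r => //.
  have : C * (`|x| + `|y|) <= C * (2 * rho) by apply: (ler_wpM2l (ltW C0)); lra.
  lra.
have h0 : h 0 = 0 by rewrite /h m0 scaler0.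
have hh : half_tangent_id h rho.
  by move=> x y xr yr; have := h20 _ _ xr yr; have := normr_ge0 (x - y); lra.
have /choice [sigma sP] : forall y, exists x, `|y| <= rho ->
    `|x| <= rho /\ h x = 2^-1 *: y.
  move=> y; have [yr|] := boolP (`|y| <= rho); last by exists 0.
  have ny : `|2^-1 *: y| = 2^-1 * `|y| by rewrite normrZ ger0_norm; lra.
  have [|x xv hx] := half_tangent_surj h0 hh (y := 2^-1 *: y); first by lra.
  by exists x => _; split=> //; lra.
have s_sub x y : `|x| <= rho -> `|y| <= rho ->
    `|sigma x - sigma y| <= 10 / 19 * `|x - y|.
  move=> xr yr; have [sx hx] := sP _ xr; have [sy hy] := sP _ yr.
  have := h20 _ _ sx sy; rewrite hx hy.
  have := ler_normD (2^-1 *: (x - y)) (- (2^-1 *: x - 2^-1 *: y - (sigma x - sigma y))).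
  have -> : 2^-1 *: (x - y) - (2^-1 *: x - 2^-1 *: y - (sigma x - sigma y)) =
    sigma x - sigma y by linear_identity R.
  by rewrite normrN normrZ ger0_norm; [lra|lra].
have s0 : sigma 0 = 0.
  have [|sx hx] := sP 0; first by rewrite normr0 ltW.
  apply: (half_tangent_inj hh) => //; first by rewrite normr0 ltW.
  by rewrite hx h0 scaler0.
have s_norm x : `|x| <= rho -> `|sigma x| <= 10 / 19 * `|x|.
  by move=> xr; have := s_sub x 0 xr; rewrite s0 !subr0 normr0; apply; exact: ltW.
have s_mul x : `|x| <= rho -> m (sigma x) (sigma x) = x.
  move=> xr; have [_] := sP _ xr; rewrite /h => /(congr1 (fun z => 2 *: z)).
  by rewrite !scalerA divff ?scale1r // pnatr_eq0.
have s_lip x y : `|x| <= rho -> `|y| <= rho ->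
    `|sigma x - sigma y| <= 3 / 5 * `|x - y|.
  by move=> xr yr; have := s_sub _ _ xr yr; have := normr_ge0 (x - y); lra.
exists rho; first by lra.
exists sigma; split=> // [x xr|x xr|x y xr yr gyx|x y xr yr].
- by have := s_norm _ xr; have := normr_ge0 x; lra.
- have [sx _] := sP _ xr.
  by rewrite -gm ?s_mul //; lra.
- have [sx hx] := sP _ xr.
  have my : `|m y y| <= r.
    have yr' : `|y| <= r by lra.
    have := mq y y 0 0 yr' yr'; rewrite !normr0 m0 !addr0 !subr0.
    move=> /(_ (ltW r0) (ltW r0)) le.
    have := ler_normD (m y y - (y + y)) (y + y); rewrite subrK.
    have := ler_normD y y.
    have : C * (`|y| + `|y|) * (`|y| + `|y|) <= 4 / 80 * `|y|.
      have : C * `|y| * `|y| <= 80^-1 * `|y|.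
        apply: ler_wpM2r => //; apply: le_trans rho_C.
        exact: (ler_wpM2l (ltW C0)).
      lra.
    by lra.
  have myx : m y y = x.
    by apply: ginj => //; [lra|rewrite gm //; lra].
  by apply: (half_tangent_inj hh) => //; rewrite hx /h myx.
- have [sx hx] := sP _ xr; have [sy hy] := sP _ yr.
  rewrite -normrN.
  have -> : - (sigma x - sigma y - 2^-1 *: (x - y)) =
      h (sigma x) - h (sigma y) - (sigma x - sigma y).
    by rewrite hx hy; linear_identity R.
  apply: le_trans (hq _ _ _ _) _; [by lra|by lra|].
  have nx := s_norm _ xr; have ny := s_norm _ yr; have nxy := s_sub _ _ xr yr.
  have : (`|sigma x| + `|sigma y|) * `|sigma x - sigma y| <=
      (10 / 19 * (`|x| + `|y|)) * (10 / 19 * `|x - y|).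
    by apply: ler_pM; rewrite ?addr_ge0 //; lra.
  move=> /(ler_wpM2l (ltW C0)).
  have : 0 <= C * ((`|x| + `|y|) * `|x - y|) by rewrite !mulr_ge0 ?addr_ge0 // ltW.
  lra.
Qed.

End local_group.

Section logarithm.
Context (R : realType) (E : completeNormedModType R) (G : groupType).
Implicit Types (g : E -> G) (m : E -> E -> E) (r rho C : R).

Lemma local_sqrt0 g sigma rho C : local_sqrt g sigma rho C -> sigma 0 = 0.
Proof.
case=> rho0 _ sn _ _ _ _; apply/eqP; rewrite -normr_le0.
by have := sn 0; rewrite normr0 mulr0; apply; exact: ltW.
Qed.

Lemma iter_local_sqrt_lip g sigma rho C k x y : local_sqrt g sigma rho C ->
  `|x| <= rho -> `|y| <= rho ->
  [/\ `|iter k sigma x| <= rho,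
      `|iter k sigma x| <= (3 / 5) ^+ k * `|x| &
      `|iter k sigma x - iter k sigma y| <= (3 / 5) ^+ k * `|x - y|].
Proof.
move=> S; case: (S) => rho0 _ sn _ _ sl _.
elim: k x y => [|k ih] x y xr yr; first by rewrite /= !expr0 !mul1r.
have [x1 x2 xy] := ih x y xr yr; have [y1 y2 _] := ih y x yr xr.
have p : (0 : R) <= 3 / 5 by lra.
have x3 := sn _ x1.
have expS t : (3 / 5) ^+ k.+1 * t = 3 / 5 * ((3 / 5) ^+ k * t) :> R.
  by rewrite exprS mulrA.
split; rewrite /= ?expS.
- by have := normr_ge0 (iter k sigma x); lra.
- exact: (le_trans x3 (ler_wpM2l p x2)).
- exact: (le_trans (sl _ _ x1 y1) (ler_wpM2l p xy)).
Qed.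

Lemma cvg_dist_le (u : nat -> E) (l a : E) (B : R) :
  u @ \oo --> l -> (forall k, `|u k - a| <= B) -> `|l - a| <= B.
Proof.
move=> ul ub.
have : closed_ball_ Num.norm a B l.
  apply: (@closed_cvg _ _ _ _ u (closed_ball_ Num.norm a B) _ _ l ul).
    exact: closed_closed_ball_.
  by apply: nearW => k; rewrite /closed_ball_ /= distrC.
by rewrite /closed_ball_ /= distrC.
Qed.

Lemma cvg_geometric_increments (u : nat -> E) (K q : R) :
  0 <= K -> 0 <= q < 1 -> (forall k, `|u k.+1 - u k| <= K * q ^+ k) ->
  cvgn u.
Proof.
move=> K0 /andP[q0 q1] uK.
have : cvgn (series (telescope u)).
  apply: normed_cvg.
  apply: (@series_le_cvg _ _ (geometric K q)) => [k|k|k|] /=.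
  - exact: normr_ge0.
  - by rewrite mulr_ge0 ?exprn_ge0.
  - exact: uK.
  - by apply: is_cvg_geometric_series; rewrite ger0_norm.
rewrite telescopeK.
move=> c; have -> : u = (u - cst (u 0%N)) + cst (u 0%N).
  by apply/funext => k /=; rewrite !fctE subrK.
by apply: is_cvgD => //; exact: is_cvg_cst.
Qed.

(** Koenigs linearization of [sigma].  The difference of consecutive terms of
    [2^k sigma^k x] is [2^(k+1)] times the second order term of [sigma] at
    [sigma^k x], hence [O(2^k (3/5)^(2k))]; the same bound on Lipschitz constants
    shows that the limit is tangent to the identity up to second order. *)
Lemma local_sqrt_log g sigma rho C : local_sqrt g sigma rho C ->
  exists L : E -> E,
    (forall x, `|x| <= rho -> (fun k => 2 ^+ k *: iter k sigma x) @ \oo --> L x) /\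
    (forall x y, `|x| <= rho -> `|y| <= rho ->
       `|L x - L y - (x - y)| <= 8 * C * (`|x| + `|y|) * `|x - y|).
Proof.
move=> S; case: (S) => rho0 C0 sn _ _ sl sq.
pose u x k := 2 ^+ k *: iter k sigma x.
(* q = 2 (3/5)^2 *)
pose q : R := 18 / 25.
have q01 : 0 <= q < 1 by rewrite /q; apply/andP; split; lra.
have qk0 k : 0 <= q ^+ k by rewrite exprn_ge0; case/andP: q01.
have incr x y k : `|x| <= rho -> `|y| <= rho ->
    `|u x k.+1 - u y k.+1 - (u x k - u y k)|
      <= 2 * C * (`|x| + `|y|) * `|x - y| * q ^+ k.
  move=> xr yr; have [x1 x2 xy] := iter_local_sqrt_lip k S xr yr.
  have [y1 y2 _] := iter_local_sqrt_lip k S yr xr.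
  have -> : u x k.+1 - u y k.+1 - (u x k - u y k) =
      (2 ^+ k * 2) *: (sigma (iter k sigma x) - sigma (iter k sigma y) -
                 2^-1 *: (iter k sigma x - iter k sigma y)).
    by rewrite /u exprS /=; linear_identity R.
  have p2 : (0 : R) <= 2 ^+ k by rewrite exprn_ge0.
  rewrite normrZ ger0_norm; last by rewrite mulr_ge0.
  have p3 : 0 <= (3 / 5 : R) ^+ k by rewrite exprn_ge0 //; lra.
  apply: le_trans (ler_wpM2l _ (sq _ _ x1 y1)) _; first by rewrite mulr_ge0.
  have -> : q ^+ k = 2 ^+ k * ((3 / 5) ^+ k * (3 / 5) ^+ k).
    by rewrite -!exprMn; congr (_ ^+ k); rewrite /q; lra.
  have : (`|iter k sigma x| + `|iter k sigma y|) *
     `|iter k sigma x - iter k sigma y| <=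
      ((3 / 5) ^+ k * (`|x| + `|y|)) * ((3 / 5) ^+ k * `|x - y|).
    by apply: ler_pM; rewrite ?addr_ge0 //; lra.
  move=> /(ler_wpM2l (_ : 0 <= 2 * C * 2 ^+ k)).
  by move=> /(_ ltac:(by rewrite !mulr_ge0 // ltW)); lra.
have u0 k : u 0 k = 0.
  rewrite /u (_ : iter k sigma 0 = 0) ?scaler0 //.
  by elim: k => //= k ->; exact: local_sqrt0 S.
have r0 : `|0 : E| <= rho by rewrite normr0 ltW.
have /choice [L LP] : forall x : E, exists l : E, `|x| <= rho -> u x @ \oo --> l.
  move=> x; have [xr|] := boolP (`|x| <= rho); last by exists 0.
  have : cvgn (u x).
    apply: (cvg_geometric_increments (K := 2 * C * (`|x| + `|0 : E|) * `|x - 0|) _ q01).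
      by rewrite !mulr_ge0 ?addr_ge0 // ltW.
    by move=> k; have := incr x 0 k xr r0; rewrite !u0 !subr0.
  by move=> /cvg_ex[l ul]; exists l.
exists L; split => // x y xr yr.
apply: (cvg_dist_le (u := fun k => u x k - u y k)); first by apply: cvgB; exact: LP.
move=> k; set D := _ * `|x - y|.
have D0 : 0 <= D by rewrite /D !mulr_ge0 ?addr_ge0 // ltW.
apply: (@le_trans _ _ (D * (1 - q ^+ k))); last by have := mulr_ge0 D0 (qk0 k); lra.
(* the increments are at most D q^k / 4, and 1/4 < 1 - q *)
elim: k => [|k ih]; first by rewrite /u /= !expr0 !scale1r subrr normr0 subrr mulr0.
have := ler_normD (u x k.+1 - u y k.+1 - (u x k - u y k)) (u x k - u y k - (x - y)).
rewrite addrA subrK; have := incr x y k xr yr.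
have : 0 <= D * q ^+ k by rewrite mulr_ge0.
have : D * (1 - q ^+ k.+1) = D - D * q ^+ k * (18 / 25) by rewrite exprS /q; lra.
have : 2 * C * (`|x| + `|y|) * `|x - y| * q ^+ k = D * q ^+ k / 4 by rewrite /D; lra.
by move: ih; lra.
Qed.

End logarithm.

Lemma geometric_small (R : realType) (q a eps : R) :
  0 <= q < 1 -> 0 < eps -> exists k, q ^+ k * a <= eps.
Proof.
move=> /andP[q0 q1] eps0.
have := @cvg_geometric R a q; rewrite ger0_norm // => /(_ q1).
move=> /cvgrPdist_le /(_ _ eps0) [k _ /(_ k (leqnn k))] /=.
rewrite sub0r normrN mulrC => le; exists k; exact: le_trans (ler_norm _) le.
Qed.

Definition local_expression (R : realType) (E : normedModType R) (G : groupType)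
    (g : E -> G) (phi : G -> G) (F : E -> E) : Prop :=
  exists2 delta, 0 < delta & forall x, `|x| <= delta -> phi (g x) = g (F x).

Definition differential_at0 (R : realType) (E : normedModType R)
    (F : E -> E) (A : {linear E -> E}) : Prop :=
  (exists2 K, 0 < K & forall x, `|A x| <= K * `|x|) /\
  forall eps, 0 < eps -> exists2 delta, 0 < delta &
    forall x, `|x| <= delta -> `|F x - A x| <= eps * `|x|.

Section exponential.
Context (R : realType) (E : completeNormedModType R) (G : groupType).
Implicit Types (g : E -> G) (m : E -> E -> E) (r rho C : R).

(** The exponential is [g \o e], where [e] inverts the logarithm [L].  Let [phi] be
    a morphism with local expression [F] and differential [A].  Near 0 the defect
    [D x = L (F x) - A (L x)] satisfies [D (sigma x) = D x / 2], as [phi] commutes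
    with square roots, and [D x = o(x)]; along the sequence [sigma^k x], of the
    size of [2^-k], this forces [D x = 0].  The neighbourhood depends on [phi], but
    [exp v = (exp (v / 2))^2] then extends the conclusion to the ball of radius
    [rho].  Only eigenvectors are considered, because dilations multiply the
    vectors of [V t] by a scalar; [a <= 1] keeps [a v] in the ball. *)
Lemma local_group_exp g m r C : local_group g m r C ->
  exists2 rho, 0 < rho & exists e : E -> E,
    [/\ e 0 = 0, strictly_tangent e id &
        forall (phi : G -> G) (F : E -> E) (A : {linear E -> E}),
          {morph phi : x y / (x * y)%g} -> local_expression g phi F ->
          differential_at0 F A ->
          forall v a, `|v| <= rho -> 0 < a <= 1 -> A v = a *: v ->
            phi (g (e v)) = g (e (a *: v))].
Proof.
move=> lg; have [rho _ [sigma S]] := local_group_sqrt lg.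
case: (S) => rho0 C0 sn ssq su sl _.
have [L [Lcvg Lq]] := local_sqrt_log S.
have L0 : L 0 = 0.
  have r0 : `|0 : E| <= rho by rewrite normr0 ltW.
  apply/eqP; rewrite -normr_le0 -[L 0]subr0; apply: (cvg_dist_le (Lcvg _ r0)) => k.
  rewrite subr0 normr_le0 (_ : iter k sigma 0 = 0) ?scaler0 //.
  by elim: k => //= k ->; exact: local_sqrt0 S.
have Ls x : `|x| <= rho -> L (sigma x) = 2^-1 *: L x.
  move=> xr; have sx : `|sigma x| <= rho.
    by have := sn _ xr; have := normr_ge0 x; lra.
  have Lsx := Lcvg _ sx; have := Lcvg _ xr.
  rewrite -cvg_shiftS => /(cvgZr (k := 2^-1)) Lx.
  apply: (cvg_unique _ Lsx); first exact: norm_hausdorff.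
  apply: cvg_trans Lx; rewrite (_ : (fun k => _) = (fun k => 2^-1 *: (2 ^+ k.+1 *: iter k.+1 sigma x))) //.
  apply/funext => k; rewrite exprS iterSr; linear_identity R.
have LT : strictly_tangent L id.
  move=> eps eps0; exists (Num.min rho (eps / (16 * C))).
    by rewrite lt_min rho0 divr_gt0 // mulr_gt0.
  move=> x y; rewrite !le_min => /andP[xr xe] /andP[yr ye].
  apply: le_trans (Lq _ _ xr yr) _; apply: ler_wpM2r => //.
  have C16 : 0 < 16 * C by lra.
  by move: xe ye; rewrite !ler_pdivlMr //; lra.
have [rho1 rho10 [e [Lh eP e0 eT]]] := strictly_tangent_inverse L0 LT.
pose rho2 := Num.min rho1 (rho / 2).
have rho20 : 0 < rho2 by rewrite lt_min rho10; lra.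
have rho21 : rho2 <= rho1 by rewrite ge_min lexx.
have rho22 : rho2 <= rho / 2 by rewrite ge_min lexx orbT.
exists rho2 => //; exists e; split=> // phi F A phiM [dF dF0 phiF] [[K K0 AK] FA] v a.
have eL x w : `|x| <= 2 * rho2 -> `|w| <= rho2 -> L x = w -> e w = x.
  move=> xr wr Lx; have [|ew Lew] := eP w; first by lra.
  by apply: (half_tangent_inj Lh); [lra|lra|rewrite Lew Lx].
have e_half w : `|w| <= rho2 -> (g (e (2^-1 *: w)) * g (e (2^-1 *: w)) = g (e w))%g.
  move=> wr; have [|ew Lew] := eP w; first by lra.
  have ewr : `|e w| <= rho by lra.
  rewrite -(ssq _ ewr) (eL (sigma (e w))) //.
  - by have := sn _ ewr; have := normr_ge0 (e w); lra.
  - by rewrite normrZ ger0_norm; have := normr_ge0 w; lra.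
  - by rewrite Ls // Lew.
have [d1 d10 FK] := FA 1 ltr01.
have Fb x : `|x| <= d1 -> `|F x| <= (K + 1) * `|x|.
  move=> xd; have := FK _ xd; have := AK x.
  by have := ler_normD (F x - A x) (A x); rewrite subrK; lra.
(* on the ball of radius d, F commutes with sigma and stays in the domain of L *)
pose d := Num.min (Num.min dF d1) (Num.min rho (2 * rho2 / (K + 1))).
have K10 : 0 < K + 1 by lra.
have d0 : 0 < d.
  by rewrite !lt_min dF0 d10 rho0 /= divr_gt0 // mulr_gt0.
have dP x : `|x| <= d ->
    [/\ `|x| <= dF, `|x| <= d1, `|x| <= rho & `|F x| <= 2 * rho2].
  rewrite /d !le_min => /andP[/andP[x1 x2] /andP[x3 x4]]; split => //.
  apply: le_trans (Fb _ x2) _; move: x4; rewrite ler_pdivlMr //; lra.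
have sd x : `|x| <= d -> `|sigma x| <= d.
  move=> xd; have [_ _ xr _] := dP _ xd.
  by have := sn _ xr; have := normr_ge0 x; lra.
have Fs x : `|x| <= d -> F (sigma x) = sigma (F x).
  move=> xd; have [xF _ xr Fx] := dP _ xd; have [sF _ _ Fsx] := dP _ (sd _ xd).
  by apply: su; [lra|lra|rewrite -!phiF // -phiM ssq].
pose D x := L (F x) - A (L x).
have Ds x : `|x| <= d -> D (sigma x) = 2^-1 *: D x.
  move=> xd; have [_ _ xr Fx] := dP _ xd.
  rewrite /D Fs // !Ls //; last by lra.
  by rewrite linearZ /=; linear_identity R.
have iter_d k x : `|x| <= d -> `|iter k sigma x| <= d.
  by move=> xd; elim: k => //= k /sd.
have DL k x : `|x| <= d ->
    D (iter k sigma x) = 2^-1 ^+ k *: D x /\ L (iter k sigma x) = 2^-1 ^+ k *: L x.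
  move=> xd; elim: k => [|k [ihD ihL]]; first by rewrite /= !expr0 !scale1r.
  have kd := iter_d k _ xd; have [_ _ kr _] := dP _ kd.
  by rewrite /= Ds // ihD Ls // ihL exprS !scalerA.
have small_D eta : 0 < eta -> exists2 d', 0 < d' &
    forall y, `|y| <= d' -> `|D y| <= eta * (2 * K + 2) * `|y|.
  move=> eta0; have [a1 a10 La] := LT _ eta0; have [a2 a20 Fa] := FA _ eta0.
  exists (Num.min (Num.min a1 a2) (Num.min d1 (a1 / (K + 1)))).
    by rewrite !lt_min a10 a20 d10 /= divr_gt0.
  move=> y; rewrite !le_min => /andP[/andP[y1 y2] /andP[y3 y4]].
  move: y4; rewrite ler_pdivlMr // => y4.
  have Fy := Fb _ y3; have z1 : `|0 : E| <= a1 by rewrite normr0 ltW.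
  have Fy1 : `|F y| <= a1 by lra.
  have := La _ _ Fy1 z1; have := La _ _ y1 z1.
  rewrite L0 /= !subr0 => Ly LFy; have FAy := Fa _ y2.
  have -> : D y = (L (F y) - F y) + ((F y - A y) + - A (L y - y)).
    have AB : A (L y - y) = A (L y) - A y by exact: linearB.
    by rewrite AB /D; linear_identity R.
  apply: le_trans (ler_normD _ _) _; apply: le_trans (lerD LFy (ler_normD _ _)) _.
  rewrite normrN; have := AK (L y - y).
  have := ler_wpM2l (ltW eta0) Fy; have := ler_wpM2l (ltW K0) Ly.
  lra.
have LF x : `|x| <= d -> `|x| <= 2 * rho2 -> D x = 0.
  move=> xd xr2; apply/eqP; rewrite -normr_le0 leNgt; apply/negP => Dx.
  (* small enough for |D x| <= 2 eta (2 K + 2) |L x| to contradict D x <> 0 *)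
  pose eta := `|D x| / (2 * (2 * K + 2) * (2 * `|L x| + 1)).
  have N0 : 0 < 2 * (2 * K + 2) * (2 * `|L x| + 1).
    by have := normr_ge0 (L x); have := mulr_ge0 (ltW K0) (normr_ge0 (L x)); lra.
  have [|d' d'0 Dd'] := small_D eta; first by rewrite divr_gt0.
  have [_ _ xr _] := dP _ xd.
  have q1 : ((0 : R) <= 3 / 5) && ((3 / 5 : R) < 1) by apply/andP; split; lra.
  have [k kd] := geometric_small `|x| q1 d'0.
  have [_ xk _] := iter_local_sqrt_lip k S xr xr.
  have [Dk Lk] := DL k _ xd.
  have := Dd' _ (le_trans xk kd); rewrite Dk.
  have zk : `|iter k sigma x| <= 2 * `|L (iter k sigma x)|.
    have k1 : (3 / 5 : R) ^+ k * `|x| <= 1 * `|x|.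
      by apply: ler_wpM2r => //; rewrite exprn_ile1 //; lra.
    have z0 : `|0 : E| <= 2 * rho1 by rewrite normr0; lra.
    have zr : `|iter k sigma x| <= 2 * rho1 by lra.
    have := Lh _ _ zr z0; rewrite L0 !subr0.
    have := ler_normB (L (iter k sigma x)) (L (iter k sigma x) - iter k sigma x).
    by rewrite opprB addrC subrK; lra.
  have pk : 0 < (2^-1 : R) ^+ k by rewrite exprn_gt0.
  rewrite Lk normrZ gtr0_norm // in zk; rewrite normrZ gtr0_norm //.
  move=> le; have M0 : 0 < eta * (2 * K + 2) by rewrite mulr_gt0 ?divr_gt0 //; lra.
  have := le_trans le (ler_wpM2l (ltW M0) zk).
  rewrite (_ : _ * (2 * _) = 2^-1 ^+ k * (eta * (2 * K + 2) * 2 * `|L x|)); last by ring.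
  rewrite ler_pM2l // => {}le.
  have : eta * (2 * (2 * K + 2) * (2 * `|L x| + 1)) = `|D x|.
    by rewrite /eta divfK // gt_eqF.
  have : 0 <= eta * (2 * K + 2) * `|L x| by rewrite mulr_ge0 // ltW.
  by lra.
have key w : `|w| <= rho2 -> 2 * `|w| <= d -> A w = a *: w -> `|a *: w| <= rho2 ->
    phi (g (e w)) = g (e (a *: w)).
  move=> wr wd Aw awr; have [|ew Lew] := eP w; first by lra.
  have ed : `|e w| <= d by lra.
  have [edF _ _ Fe] := dP _ ed; rewrite phiF // (eL (F (e w)) (a *: w)) //.
  have := LF _ ed ltac:(lra); rewrite /D Lew Aw => /eqP.
  by rewrite subr_eq0 => /eqP.
move=> vr /andP[a0 a1] Av.
have q1 : ((0 : R) <= 2^-1) && ((2^-1 : R) < 1) by apply/andP; split; lra.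
have [k kd] := geometric_small (2 * `|v|) q1 d0.
elim: k v vr Av kd => [|k ih] v vr Av kd.
  apply: key => //; first by move: kd; rewrite expr0 mul1r.
  rewrite normrZ gtr0_norm //; have := normr_ge0 v; nra.
have nv : `|2^-1 *: v| = 2^-1 * `|v| by rewrite normrZ ger0_norm.
have nav : `|a *: v| <= rho2.
  by rewrite normrZ gtr0_norm //; have := normr_ge0 v; nra.
have {}ih := ih (2^-1 *: v).
rewrite -e_half // phiM ih.
- rewrite -(e_half _ nav) scalerA mulrC -scalerA //.
- by rewrite nv; have := normr_ge0 v; lra.
- by rewrite linearZ /= Av !scalerA mulrC.
- by rewrite nv; move: kd; rewrite exprS; lra.
Qed.
End exponential.

(** * Products of exponentials *)

Definition lipschitzian (R : realType) (E : normedModType R) (A : E -> E) :=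
  exists2 K : R, 0 < K & forall x y, `|A x - A y| <= K * `|x - y|.

Section products.
Context (R : realType) (E : completeNormedModType R) (G : groupType).
Implicit Types (g : E -> G) (m : E -> E -> E) (r C : R) (h A : E -> E).

Lemma strictly_tangent_comp h A : A 0 = 0 ->
  strictly_tangent h id -> lipschitzian A -> strictly_tangent (h \o A) A.
Proof.
move=> A0 hT [K K0 AK] eps eps0; have [|d d0 hd] := hT (eps / K).
  by rewrite divr_gt0.
exists (d / K); first by rewrite divr_gt0.
have Ad x : `|x| <= d / K -> `|A x| <= d.
  rewrite ler_pdivlMr // => xd; have := AK x 0; rewrite A0 !subr0.
  by rewrite mulrC; move=> /le_trans; apply.
move=> x y xd yd; apply: le_trans (hd _ _ (Ad _ xd) (Ad _ yd)) _.
have := ler_wpM2l (ltW (divr_gt0 eps0 K0)) (AK x y).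
by rewrite mulrA divfK // gt_eqF.
Qed.

Lemma strictly_tangent_lip h A : strictly_tangent h A -> lipschitzian A ->
  exists2 K, 0 < K & exists2 d, 0 < d & forall x y, `|x| <= d -> `|y| <= d ->
    `|h x - h y| <= K * `|x - y|.
Proof.
move=> hT [K K0 AK]; have [d d0 hd] := hT 1 ltr01.
exists (K + 1); first by lra.
exists d => // x y xd yd; have := hd _ _ xd yd; have := AK x y.
by have := ler_normD (h x - h y - (A x - A y)) (A x - A y); rewrite subrK; lra.
Qed.

(** By the second order estimate on [m], the differential of the product at the
    identity is the addition. *)
Lemma strictly_tangent_mul g m r C h1 A1 h2 A2 :
  local_group g m r C -> h1 0 = 0 -> h2 0 = 0 ->
  strictly_tangent h1 A1 -> lipschitzian A1 ->
  strictly_tangent h2 A2 -> lipschitzian A2 ->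
  strictly_tangent (fun x => m (h1 x) (h2 x)) (fun x => A1 x + A2 x).
Proof.
move=> lg h10 h20 T1 l1 T2 l2 eps eps0.
have r0 := lg_radius lg; have C0 := lg_const lg.
have [K1 K10 [d1 d10 L1]] := strictly_tangent_lip T1 l1.
have [K2 K20 [d2 d20 L2]] := strictly_tangent_lip T2 l2.
have eps30 : 0 < eps / 3 by lra.
have [d3 d30 E1] := T1 _ eps30; have [d4 d40 E2] := T2 _ eps30.
pose M := K1 + K2; have M0 : 0 < M by rewrite addr_gt0.
pose d5 := Num.min (r / M) (eps / 3 / (2 * C * M * M)).
exists (Num.min (Num.min d1 d2) (Num.min (Num.min d3 d4) d5)).
  by rewrite !lt_min d10 d20 d30 d40 !divr_gt0 // !mulr_gt0.
move=> x y; rewrite !le_min.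
move=> /andP[/andP[x1 x2] /andP[/andP[x3 x4] /andP[x5 x6]]].
move=> /andP[/andP[y1 y2] /andP[/andP[y3 y4] /andP[y5 y6]]].
have CM0 : 0 < 2 * C * M * M by rewrite !mulr_gt0.
rewrite ler_pdivlMr // in x5; rewrite ler_pdivlMr // in x6.
rewrite ler_pdivlMr // in y5; rewrite ler_pdivlMr // in y6.
have h1n z : `|z| <= d1 -> `|h1 z| <= K1 * `|z|.
  by move=> zd; have := L1 z 0 zd; rewrite h10 !subr0 normr0; apply; exact: ltW.
have h2n z : `|z| <= d2 -> `|h2 z| <= K2 * `|z|.
  by move=> zd; have := L2 z 0 zd; rewrite h20 !subr0 normr0; apply; exact: ltW.
have small K (z : E) : K <= M -> `|z| * M <= r -> K * `|z| <= r.
  by move=> KM; apply: le_trans; rewrite mulrC ler_wpM2l.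
have K1M : K1 <= M by rewrite /M; lra.
have K2M : K2 <= M by rewrite /M; lra.
have := lg_quad lg (le_trans (h1n _ x1) (small _ _ K1M x5))
  (le_trans (h2n _ x2) (small _ _ K2M x5))
  (le_trans (h1n _ y1) (small _ _ K1M y5))
  (le_trans (h2n _ y2) (small _ _ K2M y5)).
set B := m _ _ - _ - _ => leB.
have -> : m (h1 x) (h2 x) - m (h1 y) (h2 y) - (A1 x + A2 x - (A1 y + A2 y)) =
    B + ((h1 x - h1 y - (A1 x - A1 y)) + (h2 x - h2 y - (A2 x - A2 y))).
  by rewrite /B; linear_identity R.
apply: le_trans (ler_normD _ _) _.
apply: le_trans (lerD leB (ler_normD _ _)) _.
have := E1 _ _ x3 y3; have := E2 _ _ x4 y4.
set n1 := `|h1 x - _ - _|; set n2 := `|h2 x - _ - _| => n2e n1e.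
have lx : `|h1 x - h1 y| + `|h2 x - h2 y| <= M * `|x - y|.
  by rewrite mulrDl lerD // ?L1 ?L2.
have ln : `|h1 x| + `|h2 x| + `|h1 y| + `|h2 y| <= M * (`|x| + `|y|).
  have := h1n _ x1; have := h2n _ x2; have := h1n _ y1; have := h2n _ y2.
  by rewrite /M; lra.
have le1 : (`|h1 x| + `|h2 x| + `|h1 y| + `|h2 y|) *
    (`|h1 x - h1 y| + `|h2 x - h2 y|) <=
    M * (`|x| + `|y|) * (M * `|x - y|) by apply: ler_pM; rewrite ?addr_ge0.
have {}le1 := ler_wpM2l (ltW C0) le1.
have : C * (M * (`|x| + `|y|) * (M * `|x - y|)) <= eps / 3 * `|x - y|.
  rewrite (_ : C * _ = (C * M * M * (`|x| + `|y|)) * `|x - y|); last by ring.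
  by apply: ler_wpM2r => //; lra.
by rewrite -mulrA; lra.
Qed.

Definition exp_product (I : Type) m (e : E -> E) (pi : I -> E -> E)
    (s : seq I) (v : E) : E :=
  foldr (fun i y => m (e (pi i v)) y) 0 s.

Lemma exp_product_tangent g m r C e (I : Type) (pi : I -> E -> E) (s : seq I) :
  local_group g m r C -> e 0 = 0 -> strictly_tangent e id ->
  (forall i, pi i 0 = 0 /\ lipschitzian (pi i)) ->
  [/\ exp_product m e pi s 0 = 0,
      lipschitzian (fun v => \sum_(i <- s) pi i v),
      strictly_tangent (exp_product m e pi s) (fun v => \sum_(i <- s) pi i v) &
      exists2 rho, 0 < rho & forall v, `|v| <= rho ->
        g (exp_product m e pi s v) = (\prod_(i <- s) g (e (pi i v)))%g].
Proof.
move=> lg e0 eT piP; elim: s => [|i s [p0 pl pT [rho rho0 pg]]].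
  split => //=.
  - by exists 1 => // x y; rewrite !big_nil subrr normr0 mulr_ge0.
  - move=> eps eps0; exists 1 => // x y _ _.
    by rewrite !big_nil !subrr normr0 mulr_ge0 // ltW.
  - by exists 1 => // v _; rewrite big_nil (lg_one lg).
have [pi0 pil] := piP i; have T1 := strictly_tangent_comp pi0 eT pil.
have T := strictly_tangent_mul lg _ p0 T1 pil pT pl.
have -> : (fun v => \sum_(j <- i :: s) pi j v) = (fun v => pi i v + \sum_(j <- s) pi j v).
  by apply/funext => v; rewrite big_cons.
split => /=.
- by rewrite pi0 e0 p0 (lg_mul0 lg).
- case: pil pl => K1 K10 l1 [K2 K20 l2]; exists (K1 + K2); first by rewrite addr_gt0.
  move=> x y; have := l1 x y; have := l2 x y; set a := \sum_(_ <- s) _.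
  set b := \sum_(_ <- s) _ => ab pixy.
  have -> : pi i x + a - (pi i y + b) = (pi i x - pi i y) + (a - b).
    by linear_identity R.
  by rewrite mulrDl; apply: le_trans (ler_normD _ _) (lerD _ _).
- by apply: T; rewrite /= pi0 e0.
have [K1 K10 [d1 d10 L1]] := strictly_tangent_lip T1 pil.
have [K2 K20 [d2 d20 L2]] := strictly_tangent_lip pT pl.
have r0 := lg_radius lg.
exists (Num.min (Num.min rho (Num.min d1 d2)) (Num.min (r / K1) (r / K2))).
  by rewrite !lt_min rho0 d10 d20 !divr_gt0.
move=> v; rewrite !le_min => /andP[/andP[vr /andP[v1 v2]] /andP[v3 v4]].
rewrite ler_pdivlMr // in v3; rewrite ler_pdivlMr // in v4.
rewrite big_cons (lg_mul lg) ?pg //.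
  have := L1 v 0 v1; rewrite normr0 /= pi0 e0 !subr0 => /(_ (ltW d10)).
  by move=> /le_trans; apply; rewrite mulrC.
have := L2 v 0 v2; rewrite normr0 /= p0 !subr0 => /(_ (ltW d20)).
by move=> /le_trans; apply; rewrite mulrC.
Qed.

(** The product of exponentials has strict derivative [\sum_i pi i] at 0, which is
    the identity, so it is locally onto. *)
Lemma exp_product_cover g m r C e (I : Type) (pi : I -> E -> E) (s : seq I) a :
  local_group g m r C -> e 0 = 0 -> strictly_tangent e id ->
  (forall i, pi i 0 = 0 /\ lipschitzian (pi i)) ->
  (forall v, \sum_(i <- s) pi i v = v) -> 0 < a ->
  exists2 rho, 0 < rho & forall y, `|y| <= rho -> exists2 v, `|v| <= a &
    g y = (\prod_(i <- s) g (e (pi i v)))%g.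
Proof.
move=> lg e0 eT piP pi_sum a0.
have [p0 _ pT [rho rho0 pg]] := exp_product_tangent s lg e0 eT piP.
have [|d d0 hd] := pT (2^-1); first by rewrite invr_gt0.
pose t := Num.min (Num.min a rho) d.
have t0 : 0 < t by rewrite !lt_min a0 rho0 d0.
have [ta tr td] : [/\ t <= a, t <= rho & t <= d].
  by have : t <= t by []; rewrite {2}/t !le_min => /andP[/andP[]].
exists (t / 2) => [|y yt]; first by lra.
have hh : half_tangent_id (exp_product m e pi s) t.
  move=> x z xt zt; rewrite -{2}(pi_sum x) -{2}(pi_sum z).
  by apply: hd; lra.
have [|v vy <-] := half_tangent_surj p0 hh (y := y); first by lra.
by exists v; [lra|apply: pg; lra].
Qed.

End products.

(** * Second order estimate of twice differentiable maps *)

Section calculus.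
Context (R : realType).

Lemma diff_bounded (V W : normedModType R) (f : V -> W) (x : V) :
  differentiable f x ->
  exists2 K : R, 0 < K & forall v, `|'d f x v| <= K * `|v|.
Proof.
move=> df; have : continuous 'd f x by exact: diff_continuous.
move=> /linear_bounded_continuous /linear_boundedP [M [_ hM]].
exists (Num.max M 0 + 1); first by rewrite ltr_wpDl // le_max lexx orbT.
move=> v; apply: hM.
by rewrite (@le_lt_trans _ _ (Num.max M 0)) ?le_max ?lexx // ltrDl.
Qed.

Lemma diff_first_order (V W : normedModType R) (f : V -> W) (x : V) (eps : R) :
  differentiable f x -> 0 < eps -> exists2 delta, 0 < delta &
    forall y, `|y| <= delta -> `|f (y + x) - f x - 'd f x y| <= eps * `|y|.
Proof.
move=> df eps0; have := diff_locally df => /eqaddoP /(_ _ eps0).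
move=> /nbhs_normP [d /= d0 hd]; exists (d / 2); first by rewrite divr_gt0.
move=> y yd; have := hd y; rewrite /ball_ /= sub0r normrN.
rewrite !fctE /= -addrA -opprD => -> //.
by apply: le_lt_trans yd _; rewrite ltr_pdivrMr // mulr_natr mulr2n ltrDl.
Qed.

Lemma diff_local_lip (V W : normedModType R) (f : V -> W) (x : V) :
  differentiable f x ->
  exists2 C : R, 0 < C & \forall z \near x, `|f z - f x| <= C * `|z - x|.
Proof.
move=> df; have [K K0 dK] := diff_bounded df.
have [d d0 hd] := diff_first_order df ltr01.
exists (1 + K); first by rewrite addr_gt0.
apply/nbhs_normP; exists d => //= z; rewrite /ball_ /= distrC => /ltW zd.
have := hd _ zd; rewrite subrK; have := dK (z - x).
by have := ler_normD (f z - f x - 'd f x (z - x)) ('d f x (z - x)); rewrite subrK; lra.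
Qed.

Lemma rV_norm_le (p : nat) (v : 'rV[R]_p) (B : R) :
  0 <= B -> (forall j, `|v 0 j| <= B) -> `|v| <= B.
Proof.
move=> B0 vB; rewrite [`|v|]mx_normrE; apply: bigmax_le => // -[i j] _ /=.
by rewrite ord1.
Qed.

Lemma rV_coord_le (p : nat) (v : 'rV[R]_p) (j : 'I_p) : `|v 0 j| <= `|v|.
Proof.
by rewrite [`|v|]mx_normrE; apply: (le_bigmax _ (fun ij => `|v ij.1 ij.2|) (0, j)).
Qed.

Lemma coord_is_diff (p : nat) (j : 'I_p) (v : 'rV[R]_p) :
  is_diff v (fun w : 'rV[R]_p => w 0 j : R) (fun w => w 0 j).
Proof.
have @f : {linear 'rV[R]_p -> R}.
  by exists (fun w : 'rV[R]_p => w 0 j); do 2![eexists]; do ?[constructor];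
    rewrite ?mxE // => ? *; rewrite ?mxE //; move=> ?; rewrite !mxE.
rewrite (_ : (fun _ => _) = f) //; apply: DiffDef.
  by apply: linear_differentiable; exact: coord_continuous.
by apply: diff_lin; exact: coord_continuous.
Qed.

(** The classical mean value theorem is applied to each coordinate along the
    segment; with the maximum norm no constant is lost. *)
Lemma mean_value_bound (W : normedModType R) (p : nat) (h : W -> 'rV[R]_p)
    (w0 : W) (r K : R) :
  (forall z, `|z - w0| <= r -> differentiable h z) ->
  (forall z v, `|z - w0| <= r -> `|'d h z v| <= K * `|v|) ->
  forall z z', `|z - w0| <= r -> `|z' - w0| <= r -> `|h z - h z'| <= K * `|z - z'|.
Proof.
move=> dh hK z z' zr z'r.
have K0 : 0 <= K * `|z - z'|.
  by apply: le_trans (hK z (z - z') zr).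
apply: rV_norm_le => // j.
pose path (t : R) := z' + t *: (z - z').
have pathr t : 0 <= t <= 1 -> `|path t - w0| <= r.
  move=> /andP[t0 t1].
  have -> : path t - w0 = t *: (z - w0) + (1 - t) *: (z' - w0).
    by rewrite /path; linear_identity R.
  apply: le_trans (ler_normD _ _) _; rewrite !normrZ ger0_norm // ger0_norm ?subr_ge0 //.
  have := ler_wpM2l t0 zr; have : 0 <= 1 - t by lra.
  by move=> /ler_wpM2l /(_ _ _ z'r); lra.
pose u (t : R) : R := h (path t) 0 j.
have diffu (t : R) : 0 <= t <= 1 ->
    is_diff t u (fun s => 'd h (path t) (s *: (z - z')) 0 j).
  move=> /pathr /dh dht.
  have dpath : is_diff t path (fun s => s *: (z - z')).
    have [dp pE] := is_diffD (is_diff_cst z' t) (is_diff_scalel t (z - z')).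
    have -> : path = cst z' + ( *:%R ^~ (z - z')) by apply/funext.
    by apply: DiffDef => //; rewrite pE add0r.
  have dhp : is_diff t (h \o path) ('d h (path t) \o (fun s => s *: (z - z'))).
    apply: is_diff_comp; exact: differentiableP.
  have := is_diff_comp dhp (coord_is_diff j (h (path t))).
  by [].
have du (t : R) : 0 <= t <= 1 -> is_derive t 1 u ('d h (path t) (z - z') 0 j).
  move=> /diffu [dut uE]; apply: DeriveDef; first exact: diff_derivable.
  by rewrite deriveE // uE scale1r.
have [||c c01] := @MVT_segment R u (fun t => 'd h (path t) (z - z') 0 j) 0 1 ler01.
- by move=> t; rewrite in_itv /= => /andP[t0 t1]; apply: du; rewrite !ltW.
- apply: continuous_in_subspaceT => t; rewrite inE /= in_itv /= => /diffu [dut _].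
  exact: differentiable_continuous.
rewrite subr0 mulr1 /u /path scale1r scale0r addr0 [z' + _]addrC subrK => e.
rewrite !mxE e; apply: le_trans (rV_coord_le _ _) _; apply: hK; apply: pathr.
by move: c01; rewrite in_itv.
Qed.

(** The differential of [f - 'd f w0] at [z] has norm [O(|z - w0|)]: it suffices to
    know this on the finite generating family [b], where it holds because
    [z |-> 'd f z (b i)] is differentiable at [w0].  The mean value bound on the
    smallest ball around [w0] that contains [z] and [z'] concludes. *)
Lemma second_order_bound (W : normedModType R) (p : nat) (f : W -> 'rV[R]_p)
    (w0 : W) (I : finType) (b : I -> W) (c : I -> W -> R) :
  (forall v, v = \sum_i c i v *: b i) -> (forall i v, `|c i v| <= `|v|) ->
  (\forall z \near w0, differentiable f z) ->
  (forall v, differentiable (fun z => 'd f z v) w0) ->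
  exists2 r : R, 0 < r & exists2 C : R, 0 < C &
    forall z z', `|z - w0| <= r -> `|z' - w0| <= r ->
      `|f z - f z' - 'd f w0 (z - z')|
        <= C * (`|z - w0| + `|z' - w0|) * `|z - z'|.
Proof.
move=> bc c1 df ddf.
have /choice [C CP] : forall i, exists C : R, 0 < C /\ \forall z \near w0,
    `|'d f z (b i) - 'd f w0 (b i)| <= C * `|z - w0|.
  by move=> i; have [C C0] := diff_local_lip (ddf (b i)); exists C.
have : \forall z \near w0, differentiable f z /\
    forall i, `|'d f z (b i) - 'd f w0 (b i)| <= C i * `|z - w0|.
  by apply: filterI => //; apply: filter_forall => i; case: (CP i).
move=> /nbhs_normP [r0 /= r00 hr].
have dfw0 : differentiable f w0 by exact: nbhs_singleton df.
exists (r0 / 2); first by rewrite divr_gt0.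
exists (\sum_i C i + 1).
  by rewrite ltr_wpDl // sumr_ge0 // => i _; case: (CP i) => /ltW.
move=> z z' zr z'r.
pose h y := f y - 'd f w0 y.
set t := `|z - w0| + `|z' - w0|.
have inr y : `|y - w0| <= r0 / 2 -> ball_ Num.norm w0 r0 y.
  by rewrite /ball_ /= distrC; lra.
have -> : f z - f z' - 'd f w0 (z - z') = h z - h z'.
  by rewrite /h linearB; linear_identity R.
have dhE y : `|y - w0| <= r0 / 2 -> is_diff y h (fun v => 'd f y v - 'd f w0 v).
  move=> /inr /hr [dfy _].
  have d0c : continuous 'd f w0 by exact: diff_continuous.
  have d0 : is_diff y ('d f w0) ('d f w0).
    by apply: DiffDef; [exact: linear_differentiable|exact: diff_lin].
  exact: is_diffB (differentiableP dfy) d0.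
pose T := Num.max `|z - w0| `|z' - w0|.
have T_le y : `|y - w0| <= T -> `|y - w0| <= r0 / 2.
  by move=> yT; apply: le_trans yT _; rewrite ge_max zr z'r.
have Tt : T <= t by rewrite ge_max; apply/andP; split; rewrite /t ?lerDl ?lerDr.
have S0 : 0 <= \sum_i C i by apply: sumr_ge0 => i _; case: (CP i) => /ltW.
apply: (@le_trans _ _ ((\sum_i C i * T) * `|z - z'|)); last first.
  rewrite -mulr_suml; apply: ler_wpM2r => //; apply: ler_pM => //; last by rewrite lerDl.
  by rewrite le_max normr_ge0.
apply: (mean_value_bound (r := T) (w0 := w0)) => [y /T_le yr|y v yT||].
- by have [] := dhE _ yr.
- have [_ ->] := dhE _ (T_le _ yT).
  have [_ hC] := hr _ (inr _ (T_le _ yT)).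
  have -> : 'd f y v - 'd f w0 v = \sum_i c i v *: ('d f y (b i) - 'd f w0 (b i)).
    have lin (l : {linear W -> 'rV[R]_p}) : l v = \sum_i c i v *: l (b i).
      by rewrite {1}(bc v) linear_sum; apply: eq_bigr => i _; rewrite linearZ.
    by rewrite !lin -sumrB; apply: eq_bigr => i _; rewrite scalerBr.
  rewrite mulr_suml; apply: le_trans (ler_norm_sum _ _ _) _.
  apply: ler_sum => i _; rewrite normrZ mulrC; apply: ler_pM => //.
  apply: le_trans (hC i) _; apply: ler_wpM2l yT.
  by case: (CP i) => /ltW.
- by rewrite le_max lexx.
- by rewrite le_max lexx orbT.
Qed.

End calculus.

(** * Lie groups in a chart at the identity *)

Lemma little_o_homogeneous0 (R : realType) (V W : normedModType R) (l : V -> W) :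
  (forall a x, l (a *: x) = a *: l x) ->
  (forall eps, 0 < eps -> exists2 delta, 0 < delta &
     forall x, `|x| <= delta -> `|l x| <= eps * `|x|) ->
  forall x, l x = 0.
Proof.
move=> lZ lo x; have [->|x0] := eqVneq x 0; first by rewrite -(scale0r 0) lZ scale0r.
have nx : 0 < `|x| by rewrite normr_gt0.
apply/eqP; rewrite -normr_le0; apply/ler_addgt0Pl => eps eps0; rewrite addr0.
have [|d d0 ld] := lo (eps / `|x|); first by rewrite divr_gt0.
pose t := d / `|x|; have t0 : 0 < t by rewrite divr_gt0.
have nt : `|t *: x| = d by rewrite normrZ gtr0_norm // /t divfK // gt_eqF.
have := ld (t *: x); rewrite nt lexx lZ normrZ gtr0_norm // => /(_ isT).
have -> : eps / `|x| * d = t * eps by rewrite /t; ring.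
by rewrite ler_pM2l.
Qed.

Section lie_chart.
Context (R : realType) (n : nat) (G : lieGroupType R n) (c : chart R n G).
Hypotheses (hc : lie_atlas c) (hc1 : chart_dom c 1%g).

(** The coordinates of [c], translated so that the identity has coordinate 0; these
    two maps are unrelated to the exponential of the group. *)
Definition centred_inv (x : 'rV[R]_n) : G := chart_inv c (x + chart_map c 1%g).

Definition centred_map (p : G) : 'rV[R]_n := chart_map c p - chart_map c 1%g.

Local Notation x0 := (chart_map c 1%g).

Lemma chart_inv1 : chart_inv c x0 = 1%g.
Proof. by rewrite (chart_mapK (c := c)) // mem_set. Qed.

Lemma chart_cod1 : chart_cod c x0.
Proof. by exists 1%g. Qed.

Lemma chart_codP x : chart_cod c x ->
  chart_dom c (chart_inv c x) /\ chart_map c (chart_inv c x) = x.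
Proof. by case=> p pd <-; rewrite (chart_mapK (c := c)) // mem_set. Qed.

Lemma centred_invK x : chart_cod c (x + x0) -> centred_map (centred_inv x) = x.
Proof. by move=> /chart_codP[_]; rewrite /centred_map /centred_inv => ->; rewrite addrK. Qed.

Lemma centred_mapK p : chart_dom c p -> centred_inv (centred_map p) = p.
Proof.
by move=> pd; rewrite /centred_inv /centred_map subrK (chart_mapK (c := c)) // mem_set.
Qed.

Lemma chart_inv_continuous1 : {for x0, continuous (chart_inv c)}.
Proof.
have := @chart_inv_cont R n G c; rewrite continuous_open_subspace; last exact: chart_cod_open.
by apply; apply/mem_set; exact: chart_cod1.
Qed.

Lemma chart_map_continuous1 : {for 1%g, continuous (chart_map c)}.
Proof.
have := @chart_map_cont R n G c; rewrite continuous_open_subspace; last exact: chart_dom_open.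
by apply; exact/mem_set.
Qed.

Lemma near_chart_cod : \forall x \near x0, chart_cod c x.
Proof. by apply: open_nbhs_nbhs; split; [exact: chart_cod_open|exact: chart_cod1]. Qed.

Lemma lie_mul_continuous : continuous (fun p : G * G => (p.1 * p.2)%g).
Proof. by have [] := @lie_mul_smooth R n G. Qed.

Definition chart_mul (z : 'rV[R]_n * 'rV[R]_n) : 'rV[R]_n :=
  chart_map c (chart_inv c z.1 * chart_inv c z.2)%g.

Definition chart_mul_dom : set ('rV[R]_n * 'rV[R]_n) :=
  (chart_cod c `*` chart_cod c) `&`
  [set z | chart_dom c (chart_inv c z.1 * chart_inv c z.2)%g].

Lemma near_chart_mul_dom : \forall z \near (x0, x0), chart_mul_dom z.
Proof.
apply: filterI.
  by exists (chart_cod c, chart_cod c) => //=; split; exact: near_chart_cod.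
have cont : {for (x0, x0), continuous (fun z : 'rV[R]_n * 'rV[R]_n =>
    (chart_inv c z.1 * chart_inv c z.2)%g)}.
  have pc : {for (x0, x0), continuous (fun z : 'rV[R]_n * 'rV[R]_n =>
      (chart_inv c z.1, chart_inv c z.2))}.
    apply: cvg_pair.
      by apply: (continuous_comp (f := fst)); [exact: cvg_fst|exact: chart_inv_continuous1].
    by apply: (continuous_comp (f := snd)); [exact: cvg_snd|exact: chart_inv_continuous1].
  apply: (@continuous_comp _ _ _ (fun z => (chart_inv c z.1, chart_inv c z.2))
    (fun p : G * G => (p.1 * p.2)%g)); first exact: pc.
  exact: lie_mul_continuous.
apply: cont; rewrite /= chart_inv1 monoid.mulg1.
by apply: open_nbhs_nbhs; split; [exact: chart_dom_open|].
Qed.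

Lemma chart_mul_diff z : chart_mul_dom z -> differentiable chart_mul z.
Proof.
by move=> zU; have [_ /(_ c c c hc hc hc 1%N) [d _]] := @lie_mul_smooth R n G; exact: d.
Qed.

Lemma chart_mul_diff2 z v : chart_mul_dom z ->
  differentiable (fun y => 'd chart_mul y v) z.
Proof.
move=> zU; have [_ /(_ c c c hc hc hc 2%N) [_ /(_ v) [d _]]] := @lie_mul_smooth R n G.
exact: d.
Qed.

Lemma chart_mulx1 x : chart_cod c x -> chart_mul (x, x0) = x.
Proof. by move=> /chart_codP[_ xE]; rewrite /chart_mul /= chart_inv1 monoid.mulg1. Qed.

Lemma chart_mul1x x : chart_cod c x -> chart_mul (x0, x) = x.
Proof. by move=> /chart_codP[_ xE]; rewrite /chart_mul /= chart_inv1 monoid.mul1g. Qed.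

End lie_chart.

Section lie_local_group.
Context (R : realType) (n : nat) (G : lieGroupType R n) (c : chart R n G).
Hypotheses (hc : lie_atlas c) (hc1 : chart_dom c 1%g).
Local Notation x0 := (chart_map c 1%g).
Local Notation E := 'rV[R]_n.

(** Multiplying by the identity does nothing, so [u - 'd chart_mul (u, 0)] is
    [o(u)]; being homogeneous, it vanishes. *)
Lemma chart_mul_d0l (u : E) : 'd (chart_mul c) (x0, x0) (u, 0) = u.
Proof.
have dM : differentiable (chart_mul c) (x0, x0).
  by apply: chart_mul_diff => //; apply: nbhs_singleton; exact: near_chart_mul_dom.
apply/eqP; rewrite eq_sym -subr_eq0; apply/eqP; move: u.
apply: little_o_homogeneous0 => [a u|eps eps0].
  have -> : (a *: u, 0) = a *: (u, 0) :> E * E by congr (_, _); rewrite scaler0.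
  by rewrite linearZ /= scalerBr.
have [d d0 hd] := diff_first_order dM eps0.
have /nbhs_normP [e /= e0 he] := near_chart_cod hc1.
exists (Num.min d (e / 2)); first by rewrite lt_min d0 divr_gt0.
move=> u; rewrite le_min => /andP[ud ue].
have nu : `|(u, 0) : E * E| = `|u| by rewrite prod_normE /= normr0 max_l.
have := hd (u, 0); rewrite nu => /(_ ud).
have -> : (u, 0) + (x0, x0) = (u + x0, x0) :> E * E by congr (_, _); rewrite add0r.
have cu : chart_cod c (u + x0).
  by apply: he; rewrite /ball_ /= opprD addrCA subrr addr0 normrN; lra.
by rewrite !chart_mulx1 //; [rewrite addrK|exact: chart_cod1].
Qed.

Lemma chart_mul_d0r (u : E) : 'd (chart_mul c) (x0, x0) (0, u) = u.
Proof.
have dM : differentiable (chart_mul c) (x0, x0).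
  by apply: chart_mul_diff => //; apply: nbhs_singleton; exact: near_chart_mul_dom.
apply/eqP; rewrite eq_sym -subr_eq0; apply/eqP; move: u.
apply: little_o_homogeneous0 => [a u|eps eps0].
  have -> : (0, a *: u) = a *: (0, u) :> E * E by congr (_, _); rewrite scaler0.
  by rewrite linearZ /= scalerBr.
have [d d0 hd] := diff_first_order dM eps0.
have /nbhs_normP [e /= e0 he] := near_chart_cod hc1.
exists (Num.min d (e / 2)); first by rewrite lt_min d0 divr_gt0.
move=> u; rewrite le_min => /andP[ud ue].
have nu : `|(0, u) : E * E| = `|u| by rewrite prod_normE /= normr0 max_r.
have := hd (0, u); rewrite nu => /(_ ud).
have -> : (0, u) + (x0, x0) = (x0, u + x0) :> E * E by congr (_, _); rewrite add0r.
have cu : chart_cod c (u + x0).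
  by apply: he; rewrite /ball_ /= opprD addrCA subrr addr0 normrN; lra.
by rewrite !chart_mul1x //; [rewrite addrK|exact: chart_cod1].
Qed.

Lemma chart_mul_d0 (v : E * E) : 'd (chart_mul c) (x0, x0) v = v.1 + v.2.
Proof.
have -> : v = (v.1, 0) + (0, v.2).
  by rewrite [LHS]surjective_pairing; congr (_, _); rewrite /= ?addr0 ?add0r.
by rewrite linearD chart_mul_d0l chart_mul_d0r /= addr0 add0r.
Qed.

(** The pairs of a unit vector and 0 generate the product space. *)
Lemma chart_mul_second_order :
  exists2 r : R, 0 < r & exists2 C : R, 0 < C &
    forall z z' : E * E, `|z - (x0, x0)| <= r -> `|z' - (x0, x0)| <= r ->
      `|chart_mul c z - chart_mul c z' - 'd (chart_mul c) (x0, x0) (z - z')|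
        <= C * (`|z - (x0, x0)| + `|z' - (x0, x0)|) * `|z - z'|.
Proof.
pose b (i : 'I_n + 'I_n) : E * E :=
  match i with inl j => (delta_mx 0 j, 0) | inr j => (0, delta_mx 0 j) end.
pose co (i : 'I_n + 'I_n) (v : E * E) : R :=
  match i with inl j => v.1 0 j | inr j => v.2 0 j end.
apply: (second_order_bound (b := b) (c := co)).
- move=> v; rewrite big_sumType /=.
  rewrite [LHS]surjective_pairing {1}(row_sum_delta v.1) {1}(row_sum_delta v.2).
  have -> : \sum_(i < n) v.1 0 i *: (delta_mx 0 i, 0) =
      (\sum_(i < n) v.1 0 i *: delta_mx 0 i, 0) :> E * E.
    elim/big_rec2: _ => // i y1 _ _ ->.
    by congr (_, _); rewrite /= ?scaler0 ?addr0.
  have -> : \sum_(i < n) v.2 0 i *: (0, delta_mx 0 i) =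
      (0, \sum_(i < n) v.2 0 i *: delta_mx 0 i) :> E * E.
    elim/big_rec2: _ => // i y1 _ _ ->.
    by congr (_, _); rewrite /= ?scaler0 ?addr0.
  by congr (_, _); rewrite /= ?addr0 ?add0r.
- move=> [j|j] v /=; rewrite prod_normE le_max.
    by rewrite rV_coord_le.
  by rewrite rV_coord_le orbT.
- by apply: filterS (near_chart_mul_dom hc1) => z; exact: chart_mul_diff.
- move=> v; apply: chart_mul_diff2 => //.
  by apply: nbhs_singleton; exact: near_chart_mul_dom.
Qed.

Definition centred_mul (x y : E) : E := chart_mul c (x + x0, y + x0) - x0.

Lemma lie_local_group :
  exists r C, local_group (centred_inv c) centred_mul r C.
Proof.
have [r1 r10 [C C0 hC]] := chart_mul_second_order.
have /nbhs_normP [r2 /= r20 hr2] := near_chart_mul_dom hc1.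
pose r := Num.min r1 (r2 / 2); exists r, C.
have shift x y : (x + x0, y + x0) - (x0, x0) = (x, y) :> E * E.
  by congr (_, _); rewrite /= addrK.
have rr1 : r <= r1 by rewrite ge_min lexx.
have rr2 : r <= r2 / 2 by rewrite ge_min lexx orbT.
have pair_le x y : `|x| <= r -> `|y| <= r -> `|(x, y) : E * E| <= r.
  by move=> xr yr; rewrite prod_normE ge_max xr yr.
have pair_sum x y : `|(x, y) : E * E| <= `|x| + `|y|.
  by rewrite prod_normE ge_max /= lerDl lerDr !normr_ge0.
have dom x y : `|x| <= r -> `|y| <= r -> chart_mul_dom c (x + x0, y + x0).
  move=> xr yr; apply: hr2; rewrite /ball_ /= -normrN opprB shift.
  by apply: le_lt_trans (pair_le _ _ xr yr) _; lra.
have cod x : `|x| <= r -> chart_cod c (x + x0) by move=> xr; case: (dom x x xr xr) => -[].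
split=> //.
- by rewrite lt_min r10 divr_gt0.
- by rewrite /centred_inv add0r chart_inv1.
- move=> x y xr yr; rewrite -{2}(centred_invK (cod _ xr)) -{2}(centred_invK (cod _ yr)).
  by move=> ->.
- move=> x y xr yr; have [_ /= pd] := dom _ _ xr yr.
  by rewrite /centred_mul /centred_inv subrK /chart_mul /= (chart_mapK (c := c)) // mem_set.
- by rewrite /centred_mul !add0r chart_mulx1 ?subrr //; exact: chart_cod1.
move=> x y x' y' xr yr x'r y'r.
have := hC (x + x0, y + x0) (x' + x0, y' + x0); rewrite !shift chart_mul_d0 /=.
move=> /(_ (le_trans (pair_le _ _ xr yr) rr1) (le_trans (pair_le _ _ x'r y'r) rr1)).
have -> : (x + x0, y + x0) - (x' + x0, y' + x0) = (x - x', y - y') :> E * E.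
  by congr (_, _); rewrite /= opprD addrACA subrr addr0.
have -> : centred_mul x y - centred_mul x' y' - (x + y - (x' + y')) =
  chart_mul c (x + x0, y + x0) - chart_mul c (x' + x0, y' + x0) -
  (x + x0 - (x' + x0) + (y + x0 - (y' + x0))).
  rewrite /centred_mul; set a := chart_mul c (x + x0, y + x0).
  by set b := chart_mul c (x' + x0, y' + x0); linear_identity R.
move=> /le_trans; apply; apply: ler_pM => //.
  by rewrite mulr_ge0 ?addr_ge0 // ltW.
rewrite ler_wpM2l ?(ltW C0) // -addrA lerD //.
Qed.

End lie_local_group.

(** * Homogeneous distances *)

Lemma morph_mulg1 (G : groupType) (phi : G -> G) :
  {morph phi : p q / (p * q)%g} -> phi 1%g = 1%g.
Proof.
move=> phiM; apply: (@monoid.mulgI _ (phi 1%g)).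
by rewrite -phiM !monoid.mulg1.
Qed.

(** The distance to the identity, a homogeneous quasi-norm on the group. *)
Definition gauge (R : realType) (G : groupType) (d : G -> G -> R) (p : G) : R :=
  d 1%g p.

Section distance.
Context (R : realType) (n : nat) (G : lieGroupType R n) (c : chart R n G).
Hypotheses (hc : lie_atlas c) (hc1 : chart_dom c 1%g).
Local Notation x0 := (chart_map c 1%g).
Local Notation E := 'rV[R]_n.

Lemma automorphism_local_expression (phi : G -> G) : lie_automorphism phi ->
  let F x := centred_map c (phi (centred_inv c x)) in
  local_expression (centred_inv c) phi F /\
  differential_at0 F ('d (chart_map c \o phi \o chart_inv c) x0).
Proof.
move=> [phiM [psi [_ _ [phic phis] _]]] F.
have phi1 := morph_mulg1 phiM.
have [dphi _] := phis c c hc hc 1%N.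
have {}dphi : differentiable (chart_map c \o phi \o chart_inv c) x0.
  apply: dphi; split; first exact: chart_cod1.
  by rewrite /= chart_inv1 // phi1.
have phi_cont : {for x0, continuous (phi \o chart_inv c)}.
  apply: continuous_comp; first exact: chart_inv_continuous1.
  exact: phic.
split.
  have /nbhs_normP [e /= e0 he] : \forall x \near x0, chart_dom c (phi (chart_inv c x)).
    apply: phi_cont; rewrite /= chart_inv1 // phi1.
    by apply: open_nbhs_nbhs; split => //; exact: chart_dom_open.
  exists (e / 2) => [|x xe]; first by rewrite divr_gt0.
  rewrite /F centred_mapK //; apply: he.
  by rewrite /ball_ /= opprD addrCA subrr addr0 normrN; lra.
split; first exact: diff_bounded.
move=> eps eps0; have [d d0 hd] := diff_first_order dphi eps0.
exists d => // x xd; have := hd x xd.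
by rewrite /= chart_inv1 // phi1.
Qed.

Lemma near1_chart (P : G -> Prop) (rho : R) : 0 < rho ->
  (forall y, `|y| <= rho -> P (centred_inv c y)) -> \forall p \near 1%g, P p.
Proof.
move=> rho0 hP.
have near_dom : \forall p \near 1%g, chart_dom c p.
  by apply: open_nbhs_nbhs; split => //; exact: chart_dom_open.
have near_map : \forall p \near 1%g, `|x0 - chart_map c p| <= rho.
  exact: (cvgrPdist_le _ _).1 (chart_map_continuous1 hc1) _ rho0.
apply: filterS2 near_dom near_map => p pd; rewrite distrC => pr.
by rewrite -(centred_mapK pd); exact: hP.
Qed.

Context (V : R -> {vspace E}) (dil : R -> G -> G) (d : G -> G -> R).
Hypothesis hgrad : positive_grading c V.
Hypothesis hdil : forall lam : R, 0 < lam -> group_dilation c V lam (dil lam).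
Hypothesis hd : homogeneous_distance dil d.

Local Notation f := (gauge d).

Lemma gauge_ge0 p : 0 <= f p.
Proof. by have [[d_ge0 _ _ _] _ _] := hd; exact: d_ge0. Qed.

Lemma gauge1 : f 1%g = 0.
Proof. by have [[_ d0 _ _] _ _] := hd; apply/d0. Qed.

Lemma gaugeE p q : d p q = f (p^-1 * q)%g.
Proof.
by have [_ dl _] := hd; rewrite -(dl p^-1%g) monoid.mulVg.
Qed.

Lemma gaugeM p q : f (p * q)%g <= f p + f q.
Proof.
have [[_ _ _ dtri] dl _] := hd; apply: le_trans (dtri _ p _) _.
by rewrite [d p _]gaugeE monoid.mulgA monoid.mulVg monoid.mul1g.
Qed.

Lemma gauge_dil lam p : 0 < lam -> f (dil lam p) = lam * f p.
Proof.
move=> lam0; have [_ _ /(_ lam 1%g p lam0) <-] := hd.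
by have [[phiM _] _] := hdil lam0; rewrite (morph_mulg1 phiM).
Qed.

Lemma gauge_prod (I : Type) (s : seq I) (F : I -> G) :
  f (\prod_(i <- s) F i)%g <= \sum_(i <- s) f (F i).
Proof.
elim: s => [|i s ih]; first by rewrite !big_nil gauge1.
by rewrite !big_cons; apply: le_trans (gaugeM _ _) _; rewrite lerD2l.
Qed.

(** Near the identity every element is a product of exponentials of multiples of
    the homogeneous components [X j i] of the unit vectors.  Each nontrivial factor
    is the image of one of the finitely many elements [exp (+- a X j i)] under a
    dilation of parameter at most 1, so its gauge is at most that of this element. *)
Lemma gauge_bounded : exists B, \forall p \near 1%g, f p <= B.
Proof.
have [r [C lg]] := lie_local_group hc hc1.
have [rho rho0 [e [e0 eT e_equi]]] := local_group_exp lg.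
have shrink t v b : 0 < t -> v \in V t -> `|v| <= rho -> 0 < b <= 1 ->
    f (centred_inv c (e (b *: v))) <= f (centred_inv c (e v)).
  move=> t0 vV vr /andP[b0 b1]; pose mu := b `^ t^-1.
  have mu0 : 0 < mu by exact: powR_gt0.
  have muE : mu `^ t = b by rewrite -powRrM mulVf ?powRr1 ?gt_eqF // ltW.
  have mu1 : mu <= 1.
    have -> : 1 = 1 `^ t^-1 :> R by rewrite powR1.
    by apply: ge0_ler_powR => //; rewrite ?nnegrE ?invr_ge0 ltW.
  have [aut [_ Adil]] := hdil mu0.
  have [loc diff0] := automorphism_local_expression aut.
  have [phiM _] := aut.
  rewrite -(e_equi _ _ _ phiM loc diff0 v b) ?b0 ?b1 //; last first.
    by rewrite -muE; exact: Adil.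
  by rewrite gauge_dil // ler_piMl // gauge_ge0.
have [[s [_ s_pos _ _ s_full]] _] := hgrad.
pose tt (i : 'I_(size s)) := nth 0 s i.
have /choice [X XP] : forall j : 'I_n, exists x : 'I_(size s) -> E,
    (forall i, x i \in V (tt i)) /\ delta_mx 0 j = \sum_i x i.
  move=> j; have : delta_mx 0 j \in (\sum_(t <- s) V t)%VS by rewrite s_full memvf.
  rewrite (big_nth 0) big_mkord => /memv_sumP [x xV xE].
  by exists x; split=> // i; exact: xV.
pose Y (ij : 'I_n * 'I_(size s)) : E := X ij.1 ij.2.
pose pi ij (v : E) : E := v 0 ij.1 *: Y ij.
have piP ij : pi ij 0 = 0 /\ lipschitzian (pi ij).
  split; first by rewrite /pi mxE scale0r.
  exists (`|Y ij| + 1); first by rewrite ltr_wpDl.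
  move=> x y; rewrite /pi -scalerBl normrZ mulrC.
  have := rV_coord_le (x - y) ij.1; rewrite !mxE => le.
  by apply: ler_pM => //; rewrite lerDl.
have pi_sum v : \sum_ij pi ij v = v.
  rewrite [RHS](row_sum_delta v) -(pair_big xpredT xpredT (fun j i => v 0 j *: X j i)) /=.
  by apply: eq_bigr => j _; rewrite -scaler_sumr (XP j).2.
pose a := rho / (\sum_ij `|Y ij| + 1).
have S0 : 0 <= \sum_ij `|Y ij| by exact: sumr_ge0.
have a0 : 0 < a by rewrite divr_gt0 // ltr_wpDl.
have aY ij : `|a *: Y ij| <= rho.
  rewrite normrZ gtr0_norm // /a mulrAC ler_pdivrMr ?ltr_wpDl // ler_pM2l //.
  by rewrite (bigD1 ij) //= -addrA lerDl addr_ge0 // sumr_ge0.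
have [rho' rho'0 cover] := exp_product_cover lg e0 eT piP pi_sum a0.
exists (\sum_ij (f (centred_inv c (e (a *: Y ij))) + f (centred_inv c (e (- (a *: Y ij)))))).
apply: (near1_chart rho'0) => y /cover [v va ->].
apply: le_trans (gauge_prod _ _) _; apply: ler_sum => ij _.
have Yv : Y ij \in V (tt ij.2) by exact: (XP ij.1).1.
have t0 : 0 < tt ij.2 by apply: s_pos; exact: mem_nth.
have vij : `|v 0 ij.1| <= a by apply: le_trans (rV_coord_le _ _) va.
have [v0|v0|v0] := ltgtP (v 0 ij.1) 0; last first.
- by rewrite /pi v0 scale0r e0 /centred_inv add0r chart_inv1 // gauge1 addr_ge0 ?gauge_ge0.
- rewrite gtr0_norm // in vij.
  have -> : pi ij v = (v 0 ij.1 / a) *: (a *: Y ij).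
    by rewrite scalerA divfK // gt_eqF.
  apply: le_trans (shrink _ _ _ t0 _ _ _) _; rewrite ?memvZ //.
    by rewrite divr_gt0 // ler_pdivrMr // mul1r.
  by rewrite lerDl gauge_ge0.
rewrite ltr0_norm // in vij.
have -> : pi ij v = (- v 0 ij.1 / a) *: (- (a *: Y ij)).
  by rewrite scalerN scalerA divfK ?gt_eqF // scaleNr opprK.
apply: le_trans (shrink _ _ _ t0 _ _ _) _; rewrite ?memvN ?memvZ ?normrN //.
  by rewrite divr_gt0 ?oppr_gt0 // ler_pdivrMr // mul1r.
by rewrite lerDr gauge_ge0.
Qed.

(** [dil lam] multiplies the gauge by [lam] and maps neighbourhoods of the identity
    to neighbourhoods of the identity. *)
Lemma gauge_small eps : 0 < eps -> \forall p \near 1%g, f p <= eps.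
Proof.
move=> eps0; have [B fB] := gauge_bounded.
have B1 : 0 < `|B| + 1 by rewrite ltr_wpDl.
pose lam := eps / (`|B| + 1); have lam0 : 0 < lam by rewrite divr_gt0.
have [[phiM [psi [phiK psiK _ [psic _]]]] _] := hdil lam0.
have psi1 : psi 1%g = 1%g by rewrite -{1}(morph_mulg1 phiM) phiK.
have : \forall p \near 1%g, f (psi p) <= B.
  by have := psic 1%g; rewrite /continuous_at psi1 => /(_ _ fB).
apply: filterS => p fp; rewrite -(psiK p) gauge_dil //.
apply: le_trans (ler_wpM2l (ltW lam0) fp) _.
rewrite /lam mulrAC ler_pdivrMr // ler_pM2l //.
by have := ler_norm B; lra.
Qed.

End distance.

Unset Implicit Arguments.

Theorem corollary2p28 (R : realType) (n : nat) (G : lieGroupType R n)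
    (c : chart R n G) (hc : lie_atlas c) (hc1 : chart_dom c 1%g)
    (V : R -> {vspace 'rV[R]_n}) (hV : homogeneous_group c V)
    (dil : R -> G -> G)
    (hdil : forall lam : R, 0 < lam -> group_dilation c V lam (dil lam))
    (d : G -> G -> R) (hd : homogeneous_distance dil d) :
  continuous (fun pq : G * G => d pq.1 pq.2).
Proof.
have hgrad : positive_grading c V by have [[]] := hV.
have [[_ _ dsym dtri] _ _] := hd.
move=> -[p q] /=; apply/cvgrPdist_le => eps eps0.
have small := gauge_small hc hc1 hgrad hdil hd.
have near_left (x : G) : \forall y \near x, d x y <= eps / 2.
  have mulx : {for x, continuous (fun y : G => (x^-1 * y)%g)}.
    apply: (@continuous_comp _ _ _ (fun y => (x^-1%g, y))
      (fun u : G * G => (u.1 * u.2)%g)); last exact: lie_mul_continuous.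
    by apply: cvg_pair; [exact: cvg_cst|exact: cvg_id].
  have : \forall y \near x, gauge d (x^-1 * y)%g <= eps / 2.
    apply: (mulx [set z | gauge d z <= eps / 2]).
    by rewrite monoid.mulVg; apply: small; rewrite divr_gt0.
  by apply: filterS => y; rewrite -(gaugeE hd).
have near_pq : \forall z \near (p, q), d p z.1 <= eps / 2 /\ d q z.2 <= eps / 2.
  exists ([set y | d p y <= eps / 2], [set y | d q y <= eps / 2]) => //.
  by split; exact: near_left.
apply: filterS near_pq => -[p' q'] /= [hp hq].
have t1 := dtri p p' q; have t2 := dtri p' q' q.
have t3 := dtri p' p q'; have t4 := dtri p q q'.
rewrite (dsym q' q) in t2; rewrite (dsym p' p) in t3.
by rewrite ler_norml; apply/andP; split; lra.
Qed.
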